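(* Let $\mu\in\mathcal P$. The two-scale solution $\mathfrak u_\mu\in\mathfrak V$, i.e. the solution of $$\mathfrak B_\mu(\mathfrak u_\mu,\mathfrak v)=\mathfrak F(\mathfrak v)\qquad\text{for all }\mathfrak v\in\mathfrak V,$$ is uniquely determined and given by $$\mathfrak u_\mu=\left(u_{H,k,\mu},\ \mathcal Q^{T_1}_{k,\mu}(u_{H,k,\mu}),\ \ldots,\ \mathcal Q^{T_{|\mathcal T_H|}}_{k,\mu}(u_{H,k,\mu})\right).$$
   Context: **Problem.** $\mathcal P\subset\mathbb R^p$ is a parameter set, $\Omega\subset\mathbb R^d$ a bounded Lipschitz domain, $V:=H^1_0(\Omega)$, $f\in L^2(\Omega)$, and for each $\mu\in\mathcal P$, $A_\mu\in L^\infty(\Omega,\mathbb R^{d\times d})$ is symmetric with $\alpha|\xi|^2\le\xi^TA_\mu(x)\xi\le\beta|\xi|^2$ for all $\mu\in\mathcal P$, $x\in\Omega$, $\xi\in\mathbb R^d$, where $0<\alpha\le\beta<\infty$ are fixed. Set $a_\mu(u,v):=\int_\Omega (A_\mu\nabla u)\cdot\nabla v\,dx$, $F(v):=\int_\Omega fv\,dx$, and for $T\subseteq\Omega$ let $a_\mu^T(u,v):=\int_T(A_\mu\nabla u)\cdot\nabla v\,dx$. Norms on $V$: $\|v\|_1^2:=\int_\Omega|\nabla v|^2dx$, $\|v\|_{a,\mu}^2:=\int_\Omega|A_\mu^{1/2}\nabla v|^2dx$. **Discretization.** $V_h\subset V$ is a (finite-dimensional) conforming finite-element space over a shape-regular mesh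 $\mathcal T_h$ of $\Omega$; $\mathcal T_H=\{T_1,\dots,T_{|\mathcal T_H|}\}$ is a coarse mesh aligned with $\mathcal T_h$; $V_H:=V_h\cap\mathcal P_1(\mathcal T_H)$, where $\mathcal P_1(\mathcal T_H)$ denotes the continuous, $\mathcal T_H$-piecewise affine functions. For $\omega\subseteq\Omega$, $U_0(\omega):=\omega$ and $U_{k+1}(\omega):=\operatorname{Int}\big(\overline{\bigcup\{T\in\mathcal T_H: \overline{U_k(\omega)}\cap\overline T\ne\emptyset\}}\big)$. Fix an integer $k\ge0$. $\mathcal I_H:V_h\to V_H$ is linear with $\mathcal I_H(v_H)=v_H$ for $v_H\in V_H$ and $\|\mathcal I_H(v_h)\|_1\le C_{\mathcal I_H}\|v_h\|_1$ for $v_h\in V_h$. **Correctors.** $V_h^{\mathrm f}:=\ker\mathcal I_H$ and $V^{\mathrm f}_{h,k,T}:=V_h^{\mathrm f}\cap H^1_0(U_k(T))$ (functions extended by zero). For $v_h\in V_h$, $\mathcal Q^T_{k,\mu}(v_h)\in V^{\mathrm f}_{h,k,T}$ is the solution of $a_\mu(\mathcal Q^T_{k,\mu}(v_h),v^{\mathrm f})=a_\mu^T(v_h,v^{\mathrm f})$ for all $v^{\mathrm f}\in V^{\mathrm f}_{h,k,T}$. Set $\mathcal Q_{k,\mu}:=\sum_{T\in\mathcal T_H}\mathcal Q^T_{k,\mu}$. **PG--LOD solution.** It is assumed that the inf-sup constant $$\gamma_k:=\inf_{0\ne w_H\in V_H}\sup_{0\ne v_H\in V_H}\frac{a_\mu(w_H-\mathcal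 Q_{k,\mu}(w_H),v_H)}{\|w_H-\mathcal Q_{k,\mu}(w_H)\|_{a,\mu}\,\|v_H\|_1}$$ is positive. Then $u_{H,k,\mu}\in V_H$ denotes the unique element with $a_\mu(u_{H,k,\mu}-\mathcal Q_{k,\mu}(u_{H,k,\mu}),v_H)=F(v_H)$ for all $v_H\in V_H$. **Two-scale objects.** $\mathfrak V:=V_H\oplus V^{\mathrm f}_{h,k,T_1}\oplus\cdots\oplus V^{\mathrm f}_{h,k,T_{|\mathcal T_H|}}$. For a fixed stabilization parameter $\rho\ge1$ and $\mathfrak u=(u_H,u^{\mathrm f}_{T_1},\dots,u^{\mathrm f}_{T_{|\mathcal T_H|}})$, $\mathfrak v=(v_H,v^{\mathrm f}_{T_1},\dots,v^{\mathrm f}_{T_{|\mathcal T_H|}})$ in $\mathfrak V$, $$\mathfrak B_\mu(\mathfrak u,\mathfrak v):=a_\mu\Big(u_H-\sum_{T\in\mathcal T_H}u^{\mathrm f}_T,\,v_H\Big)+\rho^{1/2}\sum_{T\in\mathcal T_H}\big(a_\mu(u_T^{\mathrm f},v_T^{\mathrm f})-a_\mu^T(u_H,v_T^{\mathrm f})\big),\qquad \mathfrak F(\mathfrak v):=F(v_H).$$ *)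

(* Defs.v *)
From HB Require Import structures.
From mathcomp Require Import all_boot all_order all_algebra.
From mathcomp Require Import all_classical all_reals all_analysis.

Set Implicit Arguments.
Unset Strict Implicit.
Unset Printing Implicit Defensive.

Import Order.TTheory GRing.Theory Num.Theory.
Import numFieldNormedType.Exports.
Local Open Scope classical_set_scope.
Local Open Scope ring_scope.

Definition rV_display : measure_display.
Proof. exact. Qed.

(* The sigma-algebra generated by the coordinates, i.e., the Borel sets. *)
Section measurable_rV.
Context (R : realType) (n : nat).

Let coors : 'I_n -> 'rV[R]_n -> R := fun i x => x ord0 i.

Let rV_set0 : g_sigma_preimage coors set0.
Proof. exact: sigma_algebra0. Qed.

Let rV_setC A : g_sigma_preimage coors A -> g_sigma_preimage coors (~` A).
Proof. exact: sigma_algebraC. Qed.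

Let rV_bigcup (F : (set 'rV[R]_n)^nat) :
  (forall i, g_sigma_preimage coors (F i)) ->
  g_sigma_preimage coors (\bigcup_i (F i)).
Proof. exact: sigma_algebra_bigcup. Qed.

HB.instance Definition _ := @isMeasurable.Build rV_display
  'rV[R]_n (g_sigma_preimage coors) rV_set0 rV_setC rV_bigcup.

End measurable_rV.

Section lebesgue_rV.
Context (R : realType).

Lemma measurable_rV_coord n (i : 'I_n) :
  measurable_fun [set: 'rV[R]_n] (fun x : 'rV[R]_n => x ord0 i).
Proof.
move=> _ B mB; rewrite setTI; apply: sub_sigma_algebra.
case: n i => [[]//|n] i.
rewrite -bigcup_mkord_ord; exists i => //=.
by exists B => //; rewrite setTI inord_val.
Qed.

Lemma measurable_fun_rVP d (T : measurableType d) n (f : T -> 'rV[R]_n) :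
  (forall i, measurable_fun [set: T] (fun t => f t ord0 i)) ->
  measurable_fun [set: T] f.
Proof.
move=> mf _ A mA; rewrite setTI.
suff sub : g_sigma_preimage (fun i (x : 'rV[R]_n) => x ord0 i) `<=`
    [set B | measurable (f @^-1` B)].
  exact: (sub A mA).
apply: smallest_sub.
  split=> [|B mB|F mF] /=.
  - by rewrite preimage_set0.
  - by rewrite setTD -preimage_setC; exact: measurableC.
  - by rewrite preimage_bigcup; apply: bigcup_measurable => i _; exact: mF.
clear A mA; case: n f mf => [|n] f mf; first by rewrite big_ord0.
rewrite -bigcup_mkord_ord => _ [i _ [B mB <-]] /=.
rewrite setTI -comp_preimage -[X in measurable X]setTI.
exact: (mf (inord i)).
Qed.

Definition rV_cons n (p : measurableTypeR R * 'rV[R]_n) : 'rV[R]_n.+1 :=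
  row_mx ((p.1)%:M : 'M[R]_1) p.2.
Definition rV_uncons n (x : 'rV[R]_n.+1) : measurableTypeR R * 'rV[R]_n :=
  (x ord0 ord0, @rsubmx R 1 1 n x).

Lemma rV_consK n : cancel (@rV_cons n) (@rV_uncons n).
Proof.
case=> a x; rewrite /rV_uncons /rV_cons /= row_mxKr; congr pair.
transitivity (row_mx (a%:M : 'M[R]_1) x ord0 (lshift n ord0)).
  by congr (row_mx _ _ _ _); exact/val_inj.
by rewrite row_mxEl mxE eqxx mulr1n.
Qed.

Lemma measurable_rV_cons n : measurable_fun setT (@rV_cons n).
Proof.
apply: measurable_fun_rVP => i; rewrite /rV_cons.
have [j ij|j ij] := @split_ordP 1 n i; rewrite {}ij.
  have -> : (fun p : measurableTypeR R * 'rV[R]_n =>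
      row_mx (p.1%:M : 'M[R]_1) p.2 ord0 (lshift n j)) = fst.
    by apply/funext => p; rewrite row_mxEl mxE !ord1 eqxx mulr1n.
  exact: measurable_fst.
have -> : (fun p : measurableTypeR R * 'rV[R]_n =>
    row_mx (p.1%:M : 'M[R]_1) p.2 ord0 (rshift 1 j)) =
    (fun x : 'rV[R]_n => x ord0 j) \o snd.
  by apply/funext => p; rewrite row_mxEr.
exact: measurableT_comp (measurable_rV_coord j) measurable_snd.
Qed.

Lemma measurable_rV_uncons n : measurable_fun setT (@rV_uncons n).
Proof.
apply/measurable_fun_pairP; split.
  exact: measurable_rV_coord.
apply: measurable_fun_rVP => i.
have -> : (fun x : 'rV[R]_n.+1 => (@rV_uncons n x).2 ord0 i) =
    (fun x : 'rV[R]_n.+1 => x ord0 (rshift 1 i : 'I_n.+1)).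
  by apply/funext => x; rewrite /= mxE.
exact: measurable_rV_coord.
Qed.

Section step.
Context (n : nat) (m : {sigma_finite_measure set 'rV[R]_n -> \bar R}).

Definition lebesgue_rV_step : set 'rV[R]_n.+1 -> \bar R :=
  pushforward (@lebesgue_measure R \x m)%E (@rV_cons n).

Let step0 : lebesgue_rV_step set0 = 0%E.
Proof. by rewrite /lebesgue_rV_step /pushforward preimage_set0 measure0. Qed.

Let step_ge0 A : (0 <= lebesgue_rV_step A)%E.
Proof. by rewrite /lebesgue_rV_step /pushforward measure_ge0. Qed.

Let step_sigma_additive : semi_sigma_additive lebesgue_rV_step.
Proof.
have mp B : measurable B -> measurable (@rV_cons n @^-1` B).
  by move=> mB; rewrite -[X in measurable X]setTI; exact: measurable_rV_cons.
move=> F mF tF mUF; rewrite /lebesgue_rV_step /pushforward preimage_bigcup.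
apply: measure_semi_sigma_additive.
- by move=> i; exact: mp.
- apply/trivIsetP => /= i j _ _ ij; rewrite -preimage_setI.
  by move/trivIsetP : tF => /(_ _ _ _ _ ij) ->//; rewrite preimage_set0.
- by rewrite -preimage_bigcup; exact: mp.
Qed.

HB.instance Definition _ := isMeasure.Build _ _ _
  lebesgue_rV_step step0 step_ge0 step_sigma_additive.

Let step_sigma_finite : sigma_finite setT lebesgue_rV_step.
Proof.
have /sigma_finiteP[F [UF ndF Foo]] := sigma_finiteT (@lebesgue_measure R).
have /sigma_finiteP[G [UG ndG Goo]] := sigma_finiteT m.
exists (fun i => @rV_uncons n @^-1` (F i `*` G i)).
  rewrite -preimage_bigcup -[LHS](preimage_setT (@rV_uncons n)).
  congr (_ @^-1` _).
  rewrite -setXTT UF UG predeqE => -[x y]; split.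
    move=> [/= [i _ Fix] [j _ Gjy]]; exists (maxn i j) => //; split.
      by move: x Fix; exact/subsetPset/ndF/leq_maxl.
    by move: y Gjy; exact/subsetPset/ndG/leq_maxr.
  by move=> [i _ []/= ? ?]; split; exists i.
move=> i; have [mFi Fioo] := Foo i; have [mGi Gioo] := Goo i; split.
  by rewrite -[X in measurable X]setTI; apply: measurable_rV_uncons => //;
    exact: measurableX.
rewrite /lebesgue_rV_step /pushforward -comp_preimage.
rewrite (_ : _ \o _ = id); last by apply/funext => p /=; rewrite rV_consK.
by rewrite preimage_id product_measure1E// lte_mul_pinfty// ge0_fin_numE.
Qed.

HB.instance Definition _ := Measure_isSigmaFinite.Build _ _ _
  lebesgue_rV_step step_sigma_finite.
End step.

(* The measure on the one-point space R^0 is the Dirac mass; the one on R^(n+1)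
   is the product of the Lebesgue measures on R and on R^n. *)
Fixpoint lebesgue_rV n : {sigma_finite_measure set 'rV[R]_n -> \bar R} :=
  match n with
  | 0 => @dirac _ 'rV[R]_0 0 R
  | n'.+1 => lebesgue_rV_step (lebesgue_rV n')
  end.

End lebesgue_rV.

Definition dot (R : realType) d (x y : 'rV[R]_d) : R :=
  \sum_i x ord0 i * y ord0 i.

(* `|x| is the maximum norm. *)
Definition enorm (R : realType) d (x : 'rV[R]_d) : R := Num.sqrt (dot x x).

Definition mxact (R : realType) d (M : 'M[R]_d) (x : 'rV[R]_d) : 'rV[R]_d :=
  (M *m x^T)^T.

Definition psd_sqrt_mx (R : realType) d (M : 'M[R]_d) : 'M[R]_d :=
  xget 0 [set S | [/\ S^T = S, forall x, 0 <= dot (mxact S x) x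
                    & S *m S = M]].

Section spaces.
Context (R : realType) (d : nat).
Local Notation E := 'rV[R]_d.
Local Notation mu := (@lebesgue_rV R d).
Implicit Types (D omega : set E) (v : E -> R) (g : E -> E).

Definition L2 D v : Prop :=
  measurable_fun D v /\ mu.-integrable D (fun x => (v x ^+ 2)%:E).

Definition Linfty D v : Prop :=
  measurable_fun D v /\ exists C : R, {ae mu, forall x, D x -> `|v x| <= C}.

Definition partial (i : 'I_d) v : E -> R := fun x => 'D_(delta_mx ord0 i) v x.

Fixpoint class_C (n : nat) v : Prop :=
  continuous v /\
  match n with
  | 0 => True
  | n'.+1 => forall i : 'I_d,
      (forall x, derivable v x (delta_mx ord0 i)) /\ class_C n' (partial i v)
  end.

Definition test_function omega v : Prop :=
  (forall n, class_C n v) /\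
  exists K : set E, [/\ compact K, K `<=` omega & forall x, ~ K x -> v x = 0].

(* (v, g) is the limit in L2 x L2^d of pairs (phi_n, grad phi_n) with phi_n in
   C_c^oo(omega): v, extended by zero outside omega, lies in the closure of
   C_c^oo(omega) in H^1, and g is its weak gradient (unique up to null sets). *)
Definition H10_with_gradient omega v g : Prop :=
  [/\ L2 setT v, forall i, L2 setT (fun x => g x ord0 i)
    & exists phi : nat -> E -> R,
      [/\ forall n, test_function omega (phi n),
          (fun n => \int[mu]_x ((phi n x - v x) ^+ 2)%:E)%E @ \oo --> 0%E
        & forall i, (fun n =>
            \int[mu]_x ((partial i (phi n) x - g x ord0 i) ^+ 2)%:E)%E @ \oo
              --> 0%E]].

Definition H10 omega : set (E -> R) :=
  [set v | exists g, H10_with_gradient omega v g].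

Definition gradient omega v : E -> E :=
  xget (fun=> 0) [set g | H10_with_gradient omega v g].

End spaces.

Section geometry.
Context (R : realType) (d : nat).
Local Notation E := 'rV[R]_d.

(* Near each boundary point Omega is, up to a choice of an axis e, the region
   above the graph of a Lipschitz function on the hyperplane orthogonal to e;
   psi is only evaluated on that hyperplane. *)
Definition bounded_lipschitz_domain (Omega : set E) : Prop :=
  [/\ open Omega, connected Omega, Omega !=set0, bounded_set Omega
    & forall x, (closure Omega `\` Omega) x ->
      exists (e : E) (psi : E -> R) (L : R),
        [/\ dot e e = 1,
            forall y z, `|psi y - psi z| <= L * enorm (y - z)
          & \forall y \near x,
              Omega y <-> psi (y - dot y e *: e) < dot y e]].

Definition open_convex_polytope (T : set E) : Prop :=
  T !=set0 /\
  exists m (p : 'I_m -> E),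
    T = interior [set x | exists c : 'I_m -> R,
          [/\ forall i, 0 <= c i, \sum_i c i = 1 & x = \sum_i c i *: p i]].

(* Mesh elements are represented by their interiors. *)
Definition is_mesh (Omega : set E) N (T : 'I_N -> set E) : Prop :=
  [/\ forall i, open_convex_polytope (T i), forall i, T i `<=` Omega,
      trivIset setT T & closure (\bigcup_i T i) = closure Omega].

Definition shape_regular (kappa : R) N (T : 'I_N -> set E) : Prop :=
  forall i, exists (x : E) (r : R),
    [/\ 0 < r, [set y | enorm (y - x) < r] `<=` T i
      & forall y z, T i y -> T i z -> enorm (y - z) <= kappa * r].

Definition aligned M N (Th : 'I_M -> set E) (TH : 'I_N -> set E) : Prop :=
  forall j, exists i, Th j `<=` TH i.

Definition polynomial_on (T : set E) (v : E -> R) : Prop :=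
  exists n (c : {ffun 'I_d -> 'I_n} -> R),
    forall x, T x -> v x = \sum_a c a * \prod_i x ord0 i ^+ a i.

(* Elements of a conforming finite-element space are given by their continuous
   representatives, extended by zero, so that equality in H^1_0(Omega) is plain
   equality of functions. *)
Definition conforming_fe_space (Omega : set E) M (Th : 'I_M -> set E)
    (Vh : set (E -> R)) : Prop :=
  [/\ exists n (b : 'I_n -> E -> R),
        Vh = [set v | exists c : 'I_n -> R, v = \sum_i c i *: b i],
      Vh `<=` H10 Omega
    & forall v, Vh v ->
      [/\ continuous v, forall x, ~ Omega x -> v x = 0
        & forall j, polynomial_on (Th j) v]].

Definition P1 (Omega : set E) N (TH : 'I_N -> set E) : set (E -> R) :=
  [set v | {within Omega, continuous v} /\
    forall i, exists (b : E) (c : R), forall x, TH i x -> v x = dot b x + c].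

Fixpoint patch N (TH : 'I_N -> set E) (k : nat) (omega : set E) : set E :=
  match k with
  | 0 => omega
  | k'.+1 => interior (closure (\bigcup_(i in
      [set i | closure (patch TH k' omega) `&` closure (TH i) !=set0]) TH i))
  end.

End geometry.

Section lod.
Context (R : realType) (d : nat).
Local Notation E := 'rV[R]_d.
Local Notation mu := (@lebesgue_rV R d).
Variable Omega : set E.

Definition coefficient (alpha beta : R) (A : E -> 'M[R]_d) : Prop :=
  [/\ forall i j, Linfty Omega (fun x => A x i j),
      forall x, Omega x -> (A x)^T = A x
    & forall x xi, Omega x ->
        alpha * enorm xi ^+ 2 <= dot xi (mxact (A x) xi) <=
          beta * enorm xi ^+ 2].

Local Notation grad := (gradient Omega).

Definition norm1 (v : E -> R) : R :=
  Num.sqrt (\int[mu]_(x in Omega) enorm (grad v x) ^+ 2).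

Definition load (f v : E -> R) : R := \int[mu]_(x in Omega) (f x * v x).

Section coefficient.
Variable A : E -> 'M[R]_d.

Definition bil_on (T : set E) (u v : E -> R) : R :=
  \int[mu]_(x in T) dot (mxact (A x) (grad u x)) (grad v x).

Definition bil := bil_on Omega.

Definition norm_a (v : E -> R) : R :=
  Num.sqrt
    (\int[mu]_(x in Omega) enorm (mxact (psd_sqrt_mx (A x)) (grad v x)) ^+ 2).

End coefficient.

Section discretization.
Context (N : nat) (TH : 'I_N -> set E) (Vh : set (E -> R)).

Definition VH : set (E -> R) := Vh `&` P1 Omega TH.

(* Only the restriction of IH to Vh is relevant. *)
Definition quasi_interpolation (C : R) (IH : (E -> R) -> E -> R) : Prop :=
  [/\ forall v, Vh v -> VH (IH v),
      forall a u v, Vh u -> Vh v -> IH (a *: u + v) = a *: IH u + IH v,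
      forall v, VH v -> IH v = v
    & forall v, Vh v -> norm1 (IH v) <= C * norm1 v].

Variables (IH : (E -> R) -> E -> R) (k : nat).

Definition Vf : set (E -> R) := [set v | Vh v /\ IH v = 0].

Definition VfT (i : 'I_N) : set (E -> R) := Vf `&` H10 (patch TH k (TH i)).

Variable A : E -> 'M[R]_d.

(* [xget] picks the solution, which exists and is unique by Lax-Milgram. *)
Definition corrector_on (i : 'I_N) (v : E -> R) : E -> R :=
  xget 0 [set q | VfT i q /\
    forall w, VfT i w -> bil A q w = bil_on A (TH i) v w].

Definition corrector (v : E -> R) : E -> R := \sum_i corrector_on i v.

Definition inf_sup : \bar R :=
  ereal_inf [set ereal_sup
      [set (bil A (wH - corrector wH) vH /
             (norm_a A (wH - corrector wH) * norm1 vH))%:E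
      | vH in VH `\ 0] | wH in VH `\ 0].

(* Under positivity of [inf_sup], [xget] picks the unique solution. *)
Definition pglod_solution (f : E -> R) : E -> R :=
  xget 0 [set u | VH u /\
    forall vH, VH vH -> bil A (u - corrector u) vH = load f vH].

Definition two_scale_space : set ((E -> R) * ('I_N -> E -> R)) :=
  [set u | VH u.1 /\ forall i, VfT i (u.2 i)].

Definition two_scale_form (rho : R) (u v : (E -> R) * ('I_N -> E -> R)) : R :=
  bil A (u.1 - \sum_i u.2 i) v.1 +
  Num.sqrt rho *
    \sum_i (bil A (u.2 i) (v.2 i) - bil_on A (TH i) u.1 (v.2 i)).

Definition two_scale_load (f : E -> R) (v : (E -> R) * ('I_N -> E -> R)) : R :=
  load f v.1.

Definition two_scale_solution (f : E -> R) (rho : R)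
    (u : (E -> R) * ('I_N -> E -> R)) : Prop :=
  two_scale_space u /\
  forall v, two_scale_space v -> two_scale_form rho u v = two_scale_load f v.

End discretization.
End lod.

(* Main.v *)
Require Import Defs.
From HB Require Import structures.
From mathcomp Require Import all_boot all_order all_algebra.
From mathcomp Require Import all_classical all_reals all_analysis.
From mathcomp Require Import measurable_realfun ring lra.

(** The two-scale system is triangular. Testing with a single fine component w
    in the space of the i-th patch kills the first row and leaves, because the
    weight [sqrt rho] is nonzero, exactly the equation defining the i-th
    corrector of the coarse component u_H; testing with a coarse component
    alone then leaves the PG-LOD equation for u_H. Thus a pair solves the
    system exactly when its fine components are the correctors of u_H and u_H
    solves the PG-LOD problem ([two_scale_characterization]).

    What has to be supplied is that the correctors and the PG-LOD solution
    exist and are unique. Both live in finite-dimensional spaces, where a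
    bilinear form that is nondegenerate on one side represents every linear
    form, since its Gram matrix in a basis is invertible
    ([nondegenerate_solve]). For the PG-LOD problem nondegeneracy is the
    positivity of the inf-sup constant ([inf_sup_nondegenerate]). For the
    correctors it is the definiteness of the energy form on the
    finite-element space ([Vh_definite]).

    The analysis serves the bilinearity and the definiteness of the energy
    form, which are statements about the weak gradient. Everything rests on
    one identity, that the integral over R^n of a partial derivative of a
    compactly supported C^1 function is zero ([integral_partial_eq0]). It
    gives integration by parts for test functions; from this the weak gradient
    of a function is unique almost everywhere ([H10_with_gradient_uniq]), so
    the chosen gradient is linear almost everywhere, and the Poincare
    inequality holds ([poincare]), so an element of H^1_0 with vanishing
    energy is zero almost everywhere ([bil_definite]). A continuous function
    that is zero almost everywhere is zero ([continuous_ae0]). *)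

Set Implicit Arguments.
Unset Strict Implicit.
Unset Printing Implicit Defensive.

Import Order.TTheory GRing.Theory Num.Theory.
Import numFieldNormedType.Exports.
Local Open Scope classical_set_scope.
Local Open Scope ring_scope.

(** * Borel sets of R^n *)

Section borel_rV.
Context (R : realType).

Lemma measurable_rV_box n (B : 'I_n -> set R) :
  (forall i, measurable (B i)) ->
  measurable [set x : 'rV[R]_n | forall i, B i (x ord0 i)].
Proof.
move=> mB.
rewrite (_ : mkset _ =
    \bigcap_i ((fun x : 'rV[R]_n => x ord0 i) @^-1` B i)); last first.
  by apply/seteqP; split=> [x Bx i _|x Bx i]; [exact: Bx|exact: (Bx i I)].
apply: fin_bigcap_measurable => [|i _]; first exact: finite_finset.
by rewrite -[X in measurable X]setTI; exact: measurable_rV_coord.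
Qed.

(** The sigma-algebra on R^n is generated by the coordinates; it contains the
    open sets because an open set is the union of the countably many cubes
    with rational centres and inverse-integer sizes that it contains. *)
Lemma open_measurable_rV n (U : set 'rV[R]_n) : open U -> measurable U.
Proof.
move=> oU.
pose side (p : 'rV[rat]_n * nat) i : set R :=
  `[ratr (p.1 ord0 i) - p.2.+1%:R^-1, ratr (p.1 ord0 i) + p.2.+1%:R^-1]%classic.
pose C (p : 'rV[rat]_n * nat) : set 'rV[R]_n :=
  [set x | forall i, side p i (x ord0 i)].
(* The countable family: cubes with rational centres and sides 2 / (m + 1). *)
rewrite (_ : U = \bigcup_p (if `[< C p `<=` U >] then C p else set0)).
  apply: countable_bigcupT_measurable => [|p]; first exact: countableP.
  case: ifPn => // _.
  by apply: (@measurable_rV_box _ (side p)) => i; exact: measurable_itv.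
apply/seteqP; split=> [x Ux|x [p _]]; last by case: asboolP => // + Cx; exact.
have [e /= e0 xeU] : exists2 e : R, 0 < e & ball x e `<=` U.
  by apply/nbhs_ballP; exact: open_nbhs_nbhs.
have [m me] : exists m : nat, m.+1%:R^-1 < e / 2.
  have e20 : 0 < e / 2 by rewrite divr_gt0.
  have [m _ /(_ m (leqnn m))] := near_infty_natSinv_lt (PosNum e20).
  by exists m.
have m0 : 0 < m.+1%:R^-1 :> R by rewrite invr_gt0 ltr0n.
have /choice[q qx] : forall i, exists q : rat,
    x ord0 i - m.+1%:R^-1 < ratr q < x ord0 i + m.+1%:R^-1.
  move=> i.
  have /rat_in_itvoo[q] : x ord0 i - m.+1%:R^-1 < x ord0 i + m.+1%:R^-1.
    by rewrite ltrBlDr -addrA ltrDl addr_gt0.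
  by rewrite in_itv/=; exists q.
exists (\row_i q i, m) => //.
case: asboolP => [_ i /=|[]].
  rewrite /side/= in_itv/= mxE; have /andP[] := qx i.
  by move: (m.+1%:R^-1) => r *; lra.
move=> y Cy; apply: xeU; split => // i j; rewrite ord1.
have := Cy j; have := qx j.
rewrite /side /ball/= in_itv/= mxE => /andP[h1 h2] /andP[h3 h4].
by rewrite ltr_norml; move: (m.+1%:R^-1) h1 h2 h3 h4 me => r *; lra.
Qed.

Lemma continuous_measurable_rV n (f : 'rV[R]_n -> R) :
  continuous f -> measurable_fun [set: 'rV[R]_n] f.
Proof.
move=> cf.
apply: (measurability _ (measurable_realfun.RGenOpens.measurableE R)).
move=> _ [_ [a [b ->] <-]].
rewrite setTI; apply: open_measurable_rV.
by move/continuousP : cf; apply; exact: interval_open.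
Qed.

End borel_rV.

(** * Lebesgue measure on R^n *)

Section lebesgue_box.
Context (R : realType).
Local Notation mu n := (@lebesgue_rV R n).

Lemma rV_cons0 n (p : measurableTypeR R * 'rV[R]_n) : rV_cons p ord0 ord0 = p.1.
Proof. by have /(congr1 fst) := rV_consK p. Qed.

Lemma rV_consS n (p : measurableTypeR R * 'rV[R]_n) i :
  rV_cons p ord0 (lift ord0 i) = p.2 ord0 i.
Proof.
rewrite -[in RHS](rV_consK p) [RHS]mxE.
by congr (rV_cons p _ _); exact/val_inj.
Qed.

Lemma lebesgue_rV_succ n (A : set 'rV[R]_n.+1) :
  mu n.+1 A = (@lebesgue_measure R \x mu n)%E (@rV_cons R n @^-1` A).
Proof. by []. Qed.

Definition rV_itv n (a b : 'I_n -> R) : set 'rV[R]_n :=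
  [set x | forall i, `[a i, b i]%classic (x ord0 i)].

Lemma measurable_rV_itv n (a b : 'I_n -> R) : measurable (rV_itv a b).
Proof.
apply: (@measurable_rV_box _ _ (fun i => `[a i, b i]%classic)) => i.
exact: measurable_itv.
Qed.

(** Finiteness makes bounded functions with bounded support integrable;
    positivity makes nonempty open sets non-negligible. *)
Lemma lebesgue_rV_itv n (a b : 'I_n -> R) : (forall i, a i < b i) ->
  (0 < mu n (rV_itv a b) < +oo)%E.
Proof.
elim: n a b => [|n IH] a b ab.
  rewrite [X in mu _ X](_ : _ = setT).
    by rewrite /= diracT lte01 ltry.
  by apply/seteqP; split=> // x _ [].
rewrite lebesgue_rV_succ [X in (_ \x _)%E X](_ : _ =
    `[a ord0, b ord0]%classic `*`
    rV_itv (a \o lift ord0) (b \o lift ord0)); last first.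
  apply/seteqP; split=> [p /= abp|p /= [p1 p2] i].
    split=> [|i]; first by have := abp ord0; rewrite rV_cons0.
    by have := abp (lift ord0 i); rewrite rV_consS.
  case: (unliftP ord0 i) => [j|] ->; last by rewrite rV_cons0.
  by rewrite rV_consS; exact: p2.
have /andP[m0 moo] := IH (a \o lift ord0) (b \o lift ord0) (fun i => ab _).
have l0 : @lebesgue_measure R `[a ord0, b ord0]%classic = (b ord0 - a ord0)%:E.
  by rewrite lebesgue_measure_itv /= lte_fin ab.
rewrite product_measure1E; [|exact: measurable_itv|exact: measurable_rV_itv].
rewrite [X in (X * _)%E]l0 mule_gt0 ?lte_fin ?subr_gt0//=.
by rewrite lte_mul_pinfty ?lee_fin ?subr_ge0 ?ltW.
Qed.

Lemma ler_rV_coord n (x : 'rV[R]_n) i : `|x ord0 i| <= `|x|.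
Proof.
have /mapP[j Hj ->] : `|x ord0 i| \in [seq `|x v.1 v.2| | v : 'I_1 * 'I_n].
  by apply/mapP; exists (ord0, i) => //=; rewrite mem_enum.
by rewrite [leRHS](mx_normrE x); apply/bigmax_geP; right => /=; exists j.
Qed.

Lemma rV_norm_le n (x : 'rV[R]_n) M :
  0 <= M -> (forall i, `|x ord0 i| <= M) -> `|x| <= M.
Proof.
move=> M0 xM; rewrite [leLHS](mx_normrE x).
apply/bigmax_leP; split=> //= -[i j] _ /=.
by rewrite ord1.
Qed.

Lemma continuous_support_integrable n (f : 'rV[R]_n -> R) M : continuous f ->
  (forall x, M < `|x| -> f x = 0) -> (mu n).-integrable setT (EFin \o f).
Proof.
move=> cf f0; pose M1 := `|M| + 1.
pose B := rV_itv (fun _ : 'I_n => - M1) (fun=> M1).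
have mB : measurable B by exact: measurable_rV_itv.
rewrite (_ : EFin \o f = (EFin \o f) \_ B); last first.
  apply/funext => x; rewrite patchE; case: ifPn => //= xB.
  rewrite f0// ltNge; apply: contra xB => xM; rewrite inE => i /=.
  rewrite in_itv/= -ler_norml (le_trans (ler_rV_coord x i))// (le_trans xM)//.
  by rewrite (le_trans (ler_norm M))// lerDl.
apply/(integrable_mkcond _ mB)/measurable_bounded_integrable => //.
- have /andP[//] : (0 < mu n B < +oo)%E.
  by apply: lebesgue_rV_itv => i; rewrite /M1; have := normr_ge0 M; lra.
- by apply: measurable_funTS; exact: continuous_measurable_rV.
have cB : compact B.
  apply: (@rV_compact _ _ (fun=> `[- M1, M1]%classic)) => i.
  exact: segment_compact.
have /compact_bounded[N [_ mrt]] :=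
  continuous_compact (continuous_subspaceT cf) cB.
by exists N; split; rewrite ?num_real // => ? ? ? ?; exact: mrt.
Qed.

Lemma open_lebesgue_rV_gt0 n (U : set 'rV[R]_n) : open U -> U !=set0 ->
  (0 < mu n U)%E.
Proof.
move=> oU [x Ux].
have [e /= e0 xeU] : exists2 e : R, 0 < e & ball x e `<=` U.
  by apply/nbhs_ballP; exact: open_nbhs_nbhs.
have /andP[+ _] : (0 < mu n (rV_itv (fun i => x ord0 i - e / 2)%R
    (fun i => x ord0 i + e / 2)%R) < +oo)%E.
  by apply: lebesgue_rV_itv => i; lra.
move=> /lt_le_trans; apply; apply: le_measure; rewrite ?inE.
- exact: measurable_rV_itv.
- exact: open_measurable_rV.
move=> y xy; apply: xeU; split=> // i j; rewrite ord1 /ball/=.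
have := xy j; rewrite /= in_itv/= ltr_norml => /andP[? ?]; lra.
Qed.

(** A continuous function is recovered from its almost everywhere class: its
    nonvanishing set is open, so it is empty as soon as it is negligible. *)
Lemma continuous_ae0 n (f : 'rV[R]_n -> R) : continuous f ->
  {ae mu n, forall x, f x = 0} -> f = 0.
Proof.
move=> cf [N [mN N0 fN]]; apply/funext => x; apply: contrapT => fx.
pose U := f @^-1` [set r | r != 0].
have oU : open U.
  by move/continuousP: cf; apply; exact: open_neq.
have : (0 < mu n U)%E by apply: open_lebesgue_rV_gt0 => //; exists x; apply/eqP.
rewrite ltNge => /negP; apply; rewrite -N0; apply: le_measure; rewrite ?inE //.
  exact: open_measurable_rV.
by move=> y Uy; apply: fN => /= fy; move: Uy; rewrite /U /= fy eqxx.
Qed.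

End lebesgue_box.

(** * Integrals of partial derivatives *)

Section divergence.
Context (R : realType).
Local Notation mu n := (@lebesgue_rV R n).

Lemma derive_near0 (V : normedModType R) (f : V -> R) x v M :
  (forall y, M < `|y| -> f y = 0) -> M < `|x| -> 'D_v f x = 0.
Proof.
move=> f0 Mx; rewrite -(derive_cst (0 : R) x v).
apply: near_eq_derive.
have : \forall y \near x, M < `|y|.
  by apply: (cvgr_gt `|x|) => //; exact: norm_continuous.
by apply: filterS => y; exact: f0.
Qed.

Lemma integral_derive_eq0 (g : R -> R) M :
  (forall x, derivable g x 1) -> continuous (fun x => 'D_1 g x) ->
  (forall x, M < `|x| -> g x = 0) ->
  (\int[@lebesgue_measure R]_x ('D_1 g x)%:E = 0)%E.
Proof.
move=> dg cdg g0; pose K := `|M| + 1.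
have K0 : 0 < K by rewrite ltr_wpDl.
have MK : M < K by rewrite (le_lt_trans (ler_norm M))// ltrDl.
have dg0 x : M < `|x| -> 'D_1 g x = 0 by exact: derive_near0.
have cg : continuous g.
  by move=> x; apply: differentiable_continuous; apply/derivable1_diffP.
transitivity (\int[@lebesgue_measure R]_(x in `[(- K)%R, K]) ('D_1 g x)%:E)%E.
  rewrite [RHS]integral_mkcond; apply: eq_integral => x _.
  rewrite patchE; case: ifPn => // xK; rewrite dg0//.
  rewrite ltNge; apply: contra xK => xM; rewrite inE /= in_itv/= -ler_norml.
  by rewrite (le_trans xM)// ltW.
rewrite (@continuous_FTC2 _ _ g).
- by rewrite !g0 ?subee// ?normrN gtr0_norm.
- by rewrite gtrN.
- exact: continuous_subspaceT.
- split; first by move=> x _.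
  + by apply: cvg_at_right_filter; exact: cg.
  + by apply: cvg_at_left_filter; exact: cg.
- by move=> x _; rewrite derive1E.
Qed.

(** When the inner map is affine along a line, the difference quotients of the
    composite along that line are those of the outer function. This transports
    directional derivatives where the chain rule would ask for
    differentiability. *)
Section derive_along_line.
Context (V W : normedModType R) (f : W -> R) (g : V -> W) (v x : V) (w : W).
Hypothesis gvw : forall h, g (h *: v + x) = h *: w + g x.

Let quotient_eq :
  (fun h => h^-1 *: (((fun y => f (g y)) \o shift x) (h *: v) - f (g x))) =
  (fun h => h^-1 *: ((f \o shift (g x)) (h *: w) - f (g x))).
Proof. by apply/funext => h; rewrite /= gvw. Qed.

Lemma derive_comp_line : 'D_v (fun y => f (g y)) x = 'D_w f (g x).
Proof. by rewrite /derive quotient_eq. Qed.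

Lemma derivable_comp_line :
  derivable f (g x) w -> derivable (fun y => f (g y)) x v.
Proof. by rewrite /derivable quotient_eq. Qed.

End derive_along_line.

Lemma rV_cons_shiftl n (a h : R) (y : 'rV[R]_n) :
  h *: delta_mx ord0 ord0 + rV_cons (a, y) = rV_cons (h + a, y) :> 'rV[R]_n.+1.
Proof.
apply/rowP => i; rewrite mxE [X in X + _]mxE [X in _ * X + _]mxE.
case: (unliftP ord0 i) => [j|] ->.
  by rewrite !rV_consS /= mulr0 add0r.
by rewrite !rV_cons0 eqxx mulr1.
Qed.

Lemma rV_cons_shiftr n (a h : R) (j : 'I_n) (y : 'rV[R]_n) :
  h *: delta_mx ord0 (lift ord0 j) + rV_cons (a, y) =
  rV_cons (a, h *: delta_mx ord0 j + y) :> 'rV[R]_n.+1.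
Proof.
apply/rowP => i; rewrite mxE [X in X + _]mxE [X in _ * X + _]mxE.
case: (unliftP ord0 i) => [k|] ->.
  by rewrite !rV_consS /= !mxE (inj_eq (@lift_inj _ _)).
by rewrite !rV_cons0 /= mulr0 add0r.
Qed.

Lemma rV_cons_norml n (a : R) (y : 'rV[R]_n) : `|a| <= `|rV_cons (a, y)|.
Proof. by have := ler_rV_coord (rV_cons (a, y)) ord0; rewrite rV_cons0. Qed.

Lemma rV_cons_normr n (a : R) (y : 'rV[R]_n) : `|y| <= `|rV_cons (a, y)|.
Proof.
apply: rV_norm_le => // i.
by have := ler_rV_coord (rV_cons (a, y)) (lift ord0 i); rewrite rV_consS.
Qed.

Lemma nonexpansive_continuous (V W : normedModType R) (f : V -> W) :
  (forall x y, `|f x - f y| <= `|x - y|) -> continuous f.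
Proof.
move=> fxy x; apply/cvgrPdist_le => e e0.
near=> y; apply: le_trans (fxy x y) _; near: y.
exact: (@cvgr_dist_le _ _ _ (nbhs x) _ id x cvg_id).
Unshelve. all: by end_near. Qed.

Lemma continuous_rV_consl n (y : 'rV[R]_n) :
  continuous (fun a : R => rV_cons (a, y) : 'rV[R]_n.+1).
Proof.
apply: nonexpansive_continuous => a b; apply: rV_norm_le => // i.
rewrite mxE [X in _ + X]mxE; case: (unliftP ord0 i) => [j|] ->.
  by rewrite !rV_consS subrr normr0.
by rewrite !rV_cons0.
Qed.

Lemma continuous_rV_consr n (a : R) :
  continuous (fun y : 'rV[R]_n => rV_cons (a, y) : 'rV[R]_n.+1).
Proof.
apply: nonexpansive_continuous => y z; apply: rV_norm_le => // i.
rewrite mxE [X in _ + X]mxE; case: (unliftP ord0 i) => [j|] ->; last first.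
  by rewrite !rV_cons0 subrr normr0.
by rewrite !rV_consS /=; have := ler_rV_coord (y - z) j; rewrite !mxE.
Qed.

(** The divergence theorem without boundary term, which is the source of every
    integration by parts below. The measure on R^(n+1) is built as an iterated
    product, so Fubini gives an induction on n: for the first coordinate, the
    inner integral over the line vanishes by the fundamental theorem of
    calculus; for any other coordinate, the inner integral over R^n vanishes
    by induction. *)
Lemma integral_partial_eq0 n (i : 'I_n) (f : 'rV[R]_n -> R) M : continuous f ->
  (forall x, derivable f x (delta_mx ord0 i)) -> continuous (partial i f) ->
  (forall x, M < `|x| -> f x = 0) ->
  (\int[mu n]_x (partial i f x)%:E = 0)%E.
Proof.
elim: n i f => [[]//|n IH] i f cf df cpf f0.
pose F x := (partial i f x)%:E.
have pf0 x : M < `|x| -> partial i f x = 0 by exact: derive_near0.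
have iF : (mu n.+1).-integrable setT F.
  exact: (continuous_support_integrable cpf pf0).
have mF := measurable_int _ iF.
have mc := @measurable_rV_cons R n.
have iFc : (@lebesgue_measure R \x mu n)%E.-integrable setT (F \o @rV_cons R n).
  apply/integrableP; split; first exact: measurableT_comp.
  have /integrableP[_] := iF; apply: le_lt_trans.
  rewrite [leRHS](ge0_integral_pushforward mc)//.
  exact: measurableT_comp.
rewrite [LHS](integral_pushforward mc mF iFc)//.
case: (unliftP ord0 i) => [j|] ij.
- rewrite -(integral12_prod_meas1 iFc).
  apply: integral0_eq => a _; rewrite /fubini_F.
  have gh y h : rV_cons (a, h *: delta_mx ord0 j + y) =
      h *: delta_mx ord0 i + rV_cons (a, y) :> 'rV[R]_n.+1.
    by rewrite ij rV_cons_shiftr.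
  have E y : partial j (fun y => f (rV_cons (a, y))) y =
      partial i f (rV_cons (a, y)).
    exact: (derive_comp_line f (gh y)).
  rewrite -[RHS](IH j (fun y => f (rV_cons (a, y)))).
  + by congr (integral _ _ _); apply/funext => y; rewrite E.
  + by move=> y; apply: continuous_comp; [exact: continuous_rV_consr|exact: cf].
  + by move=> y; exact: (derivable_comp_line (gh y) (df _)).
  + rewrite (_ : partial j _ = partial i f \o (fun y => rV_cons (a, y))).
      move=> y; apply: continuous_comp; last exact: cpf.
      exact: continuous_rV_consr.
    exact/funext.
  + by move=> y My; apply: f0; rewrite (lt_le_trans My)// rV_cons_normr.
- rewrite -(integral21_prod_meas1 iFc).
  apply: integral0_eq => y _; rewrite /fubini_G.
  have gh (a h : R) : rV_cons (h *: 1 + a, y) =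
      h *: delta_mx ord0 i + rV_cons (a, y) :> 'rV[R]_n.+1.
    by rewrite ij rV_cons_shiftl [h%:A]mulr1.
  have E a : 'D_1 (fun a : R => f (rV_cons (a, y))) a =
      partial i f (rV_cons (a, y)).
    exact: (derive_comp_line f (gh a)).
  rewrite -[RHS](@integral_derive_eq0 (fun a => f (rV_cons (a, y))) M).
  + by congr (integral _ _ _); apply/funext => a; rewrite E.
  + by move=> a; exact: (derivable_comp_line (gh a) (df _)).
  + rewrite (_ : (fun x => _) = partial i f \o (fun a => rV_cons (a, y))).
      move=> a; apply: continuous_comp; last exact: cpf.
      exact: continuous_rV_consl.
    exact/funext.
  + by move=> a Ma; apply: f0; rewrite (lt_le_trans Ma)// rV_cons_norml.
Qed.

End divergence.

(** * Square-integrable functions *)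

Section L2_theory.
Context (R : realType) (d : nat).
Local Notation E := 'rV[R]_d.
Local Notation mu := (@lebesgue_rV R d).
Local Notation L2T := (@L2 R d setT).
Implicit Types (u v w : E -> R).

Lemma fct_linE a u v x : (a *: u + v) x = a * u x + v x.
Proof. by []. Qed.

Lemma fctBE u v x : (u - v) x = u x - v x.
Proof. by []. Qed.

Lemma fctME u v x : (u * v) x = u x * v x.
Proof. by []. Qed.

Definition L2ip u v : R := \int[mu]_x (u x * v x).

Local Notation L2sq u := (L2ip u u).

Lemma L2_integrableM_on (D : set E) u v : measurable D -> L2 D u -> L2 D v ->
  mu.-integrable D (EFin \o (fun x => u x * v x)).
Proof.
move=> mD [meas_u iu] [mv iv].
apply: (le_integrable mD _ _ (integrableD mD iu iv)).
  by apply/measurable_EFinP; exact: measurable_funM.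
move=> x _ /=; rewrite lee_fin.
rewrite ler_norml ger0_norm ?addr_ge0 ?sqr_ge0//.
apply/andP; split; have := sqr_ge0 (u x + v x); have := sqr_ge0 (u x - v x);
  rewrite !sqrrD ?sqrrN; have := sqr_ge0 (u x); have := sqr_ge0 (v x); nra.
Qed.

Lemma L2_integrableM u v : L2T u -> L2T v ->
  mu.-integrable setT (EFin \o (fun x => u x * v x)).
Proof. exact: L2_integrableM_on. Qed.

Lemma L2ipC u v : L2ip u v = L2ip v u.
Proof. by apply: eq_Rintegral => x _; rewrite mulrC. Qed.

Lemma L2_lin a u v : L2T u -> L2T v -> L2T (a *: u + v).
Proof.
move=> Lu Lv; have iuv := L2_integrableM Lu Lv.
move: Lu Lv => [meas_u iu] [mv iv].
split.
  by apply: measurable_funD => //; exact: measurable_funM.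
have -> : (fun x => ((a *: u + v) x ^+ 2)%:E) =
  (EFin \o (fun x => a ^+ 2 * u x ^+ 2)) \+
  ((EFin \o (fun x => a *+ 2 * (u x * v x))) \+ (fun x => (v x ^+ 2)%:E)).
  apply/funext => x /=; rewrite -!EFinD; congr EFin.
  by rewrite fct_linE /=; ring.
apply: integrableD => //; first exact: (integrableZl measurableT (a ^+ 2) iu).
by apply: integrableD => //; exact: (integrableZl measurableT (a *+ 2) iuv).
Qed.

Lemma L2_0 : L2T 0.
Proof.
split; first exact: measurable_cst.
rewrite (_ : (fun x => _) = cst 0%E); first exact: integrable0.
by apply/funext => x /=; rewrite [X in X ^+ 2](_ : _ = 0)// expr0n.
Qed.

Lemma L2B u v : L2T u -> L2T v -> L2T (u - v).
Proof.
move=> Lu Lv; have := L2_lin (- 1) Lv Lu.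
by rewrite scaleN1r addrC.
Qed.

Lemma L2ip_linl a u v w : L2T u -> L2T v -> L2T w ->
  L2ip (a *: u + v) w = a * L2ip u w + L2ip v w.
Proof.
move=> Lu Lv Lw.
have iuw := L2_integrableM Lu Lw; have ivw := L2_integrableM Lv Lw.
rewrite /L2ip -RintegralZl// -RintegralD//; last first.
  exact: (integrableZl measurableT a iuw).
by apply: eq_Rintegral => x _; rewrite fct_linE /=; ring.
Qed.

Lemma L2ip_linr a u v w : L2T u -> L2T v -> L2T w ->
  L2ip w (a *: u + v) = a * L2ip w u + L2ip w v.
Proof. by move=> *; rewrite L2ipC L2ip_linl// !(L2ipC w). Qed.

Lemma L2ip_ge0 u : 0 <= L2sq u.
Proof. by apply: Rintegral_ge0 => x _; rewrite -expr2 sqr_ge0. Qed.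

Lemma L2ipBl u v w : L2T u -> L2T v -> L2T w ->
  L2ip (u - v) w = L2ip u w - L2ip v w.
Proof.
move=> Lu Lv Lw; have := L2ip_linl (- 1) Lv Lu Lw.
by rewrite scaleN1r (addrC (- v)) => ->; ring.
Qed.

(** Young's inequality in weighted form; the free weight e replaces square roots
    in all the limiting arguments. *)
Lemma L2ip_young e u v : 0 < e -> L2T u -> L2T v ->
  2 * L2ip u v <= e * L2sq u + e^-1 * L2sq v.
Proof.
move=> e0 Lu Lv.
have := L2ip_ge0 ((- e) *: u + v).
have Lw := L2_lin (- e) Lu Lv.
rewrite L2ip_linl// !L2ip_linr// (L2ipC v u) => h.
rewrite -(ler_pM2l e0) mulrDr !mulrA mulfV ?gt_eqF// mul1r; nra.
Qed.

Lemma L2ip_youngN e u v : 0 < e -> L2T u -> L2T v ->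
  - (2 * L2ip u v) <= e * L2sq u + e^-1 * L2sq v.
Proof.
move=> e0 Lu Lv.
have := L2ip_ge0 (e *: u + v).
have Lw := L2_lin e Lu Lv.
rewrite L2ip_linl// !L2ip_linr// (L2ipC v u) => h.
rewrite -(ler_pM2l e0) mulrDr !mulrA mulfV ?gt_eqF// mul1r; nra.
Qed.

Lemma L2sq_triangle u v : L2T u -> L2T v ->
  L2sq u <= 2 * L2sq v + 2 * L2sq (u - v).
Proof.
move=> Lu Lv; have := L2ip_ge0 ((- 2) *: v + u).
have L1 := L2_lin (- 2) Lv Lu; have Luv := L2B Lu Lv.
rewrite L2ip_linl// !L2ip_linr// (L2ipC u v) L2ipBl//.
by rewrite ![L2ip _ (u - v)]L2ipC !L2ipBl// (L2ipC u v); nra.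
Qed.

Lemma L2sqB_sym u v : L2sq (u - v) = L2sq (v - u).
Proof.
by apply: eq_Rintegral => x _; rewrite fctBE fctBE; ring.
Qed.

Lemma integral_sqr u v : L2T u -> L2T v ->
  (\int[mu]_x ((u x - v x) ^+ 2)%:E = (L2sq (u - v))%:E)%E.
Proof.
move=> Lu Lv; have i := L2_integrableM (L2B Lu Lv) (L2B Lu Lv).
rewrite /L2ip /Rintegral fineK; last exact: integrable_fin_num.
by apply: eq_integral => x _; rewrite fctBE expr2.
Qed.

Lemma L2sq0_ae u : L2T u -> L2sq u = 0 -> {ae mu, forall x, u x = 0}.
Proof.
move=> Lu u0; have i := L2_integrableM Lu Lu.
have mi : measurable_fun setT (EFin \o (fun x => u x * u x)).
  exact: measurable_int i.
have ui : (\int[mu]_x `|(EFin \o (fun x => u x * u x)%R) x| = 0)%E.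
  rewrite -[RHS](congr1 EFin u0) /L2ip /Rintegral fineK.
    by apply: eq_integral => x _ /=; rewrite ger0_norm// -expr2 sqr_ge0.
  exact: integrable_fin_num.
have := (ae_eq_integral_abs mu measurableT mi).1 ui.
apply: filterS => x /(_ I) /= [] /eqP.
by rewrite mulf_eq0 orbb => /eqP.
Qed.

End L2_theory.

(** * Test functions *)

Local Notation L2sq u := (L2ip u u).

Section test_functions.
Context (R : realType) (d : nat).
Local Notation E := 'rV[R]_d.
Local Notation mu := (@lebesgue_rV R d).
Local Notation L2T := (@L2 R d setT).
Implicit Types (u v w : E -> R).

Lemma class_C_continuous n u : class_C n u -> continuous u.
Proof. by case: n => [|n] []. Qed.

Lemma partial_lin i a u v : (forall x, derivable u x (delta_mx ord0 i)) ->
  (forall x, derivable v x (delta_mx ord0 i)) ->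
  partial i (a *: u + v) = a *: partial i u + partial i v.
Proof.
move=> du dv; apply/funext => x.
rewrite /partial deriveD//; last exact: derivableZ.
by rewrite deriveZ.
Qed.

Lemma partialM i u v x : derivable u x (delta_mx ord0 i) ->
  derivable v x (delta_mx ord0 i) ->
  partial i (u * v) x = u x * partial i v x + v x * partial i u x.
Proof. exact: deriveM. Qed.

Lemma continuous_lin a u v :
  continuous u -> continuous v -> continuous (a *: u + v).
Proof.
move=> cu cv x; apply: continuousD; last exact: cv.
by apply: continuousZr; exact: cu.
Qed.

Lemma class_C_lin n a u v :
  class_C n u -> class_C n v -> class_C n (a *: u + v).
Proof.
elim: n u v => [|n IH] u v [cu hu] [cv hv].
  by split=> //; exact: continuous_lin.
split=> [|i]; first exact: continuous_lin.
have [du pu] := hu i; have [dv pv] := hv i; split.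
  by move=> x; apply: derivableD => //; exact: derivableZ.
by rewrite partial_lin//; exact: IH.
Qed.

Lemma class_C0 n : class_C n (0 : E -> R).
Proof.
elim: n => [|n IH]; first by split => //; exact: cst_continuous.
split=> [|i]; first exact: cst_continuous.
split=> [x|]; first exact: derivable_cst.
rewrite (_ : partial i 0 = 0)//.
by apply/funext => x; exact: derive_cst.
Qed.

Lemma test_function0 omega : test_function omega (0 : E -> R).
Proof.
split; first by move=> n; exact: class_C0.
by exists set0; split => //; exact: compact0.
Qed.

Lemma test_function_lin omega a u v :
  test_function omega u -> test_function omega v ->
  test_function omega (a *: u + v).
Proof.
move=> [Cu [K [cK Ko Ku]]] [Cv [L [cL Lo Lv]]]; split.
  by move=> n; exact: class_C_lin.
exists (K `|` L); split; first exact: compactU.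
  by rewrite subUset.
move=> x /not_orP[Kx Lx].
by rewrite fct_linE Ku// Lv// mulr0 addr0.
Qed.

Lemma test_function_derivable omega u i x : test_function omega u ->
  derivable u x (delta_mx ord0 i).
Proof. by move=> [Cu _]; have [_ /(_ i)[]] := Cu 1%N. Qed.

Lemma test_function_partial omega u i :
  test_function omega u -> test_function omega (partial i u).
Proof.
move=> [Cu [K [cK Ko Ku]]]; split.
  by move=> n; have [_ /(_ i)[]] := Cu n.+1.
exists K; split => // x Kx.
rewrite /partial -(derive_cst (0 : R) x (delta_mx ord0 i)).
apply: near_eq_derive.
have oK : open (~` K) by apply: closed_openC; exact: compact_closed.
have := open_nbhs_nbhs (conj oK Kx).
by apply: filterS => y; exact: Ku.
Qed.

Lemma test_function_continuous omega u : test_function omega u -> continuous u.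
Proof. by move=> [Cu _]; exact: class_C_continuous (Cu 0%N). Qed.

Lemma test_function_support omega u : test_function omega u ->
  exists M, forall x, M < `|x| -> u x = 0.
Proof.
move=> [_ [K [/compact_bounded[M [_ MK]] _ Ku]]].
exists (M + 1) => x Mx; apply: Ku => Kx.
have := MK (M + 1); rewrite ltrDl ltr01 => /(_ isT x Kx) /=.
by rewrite leNgt Mx.
Qed.

Lemma continuous_support_L2 u M :
  continuous u -> (forall x, M < `|x| -> u x = 0) -> L2T u.
Proof.
move=> cu u0; split; first exact: continuous_measurable_rV.
apply: (@continuous_support_integrable _ _ (fun x => u x ^+ 2) M).
  by move=> x; apply: continuousM; exact: cu.
by move=> x /u0 ->; rewrite expr0n.
Qed.

Lemma test_function_L2 omega u : test_function omega u -> L2T u.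
Proof.
move=> tu; have [M uM] := test_function_support tu.
exact: continuous_support_L2 (test_function_continuous tu) uM.
Qed.

Lemma L2ip_partial_parts o1 o2 i u v :
  test_function o1 u -> test_function o2 v ->
  L2ip (partial i u) v = - L2ip u (partial i v).
Proof.
move=> tu tv.
have Lu := test_function_L2 tu; have Lv := test_function_L2 tv.
have Lpu := test_function_L2 (test_function_partial i tu).
have Lpv := test_function_L2 (test_function_partial i tv).
have [M uM] := test_function_support tu.
have pE : partial i (u * v) = u * partial i v + partial i u * v.
  apply/funext => x; rewrite partialM; last 2 first.
  - exact: test_function_derivable tu.
  - exact: test_function_derivable tv.
  by rewrite [v x * _]mulrC.
have : (\int[mu]_x (partial i (u * v) x)%:E = 0)%E.
  apply: (@integral_partial_eq0 _ _ i (u * v) M).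
  - move=> x; apply: continuousM; [exact: (test_function_continuous tu)|
      exact: (test_function_continuous tv)].
  - move=> x; apply: derivableM; [exact: test_function_derivable tu|
      exact: test_function_derivable tv].
  - rewrite pE => x; apply: continuousD; apply: continuousM.
    + exact: (test_function_continuous tu).
    + exact: (test_function_continuous (test_function_partial i tv)).
    + exact: (test_function_continuous (test_function_partial i tu)).
    + exact: (test_function_continuous tv).
  - by move=> x /uM ux; rewrite [LHS](_ : _ = u x * v x)// ux mul0r.
move/(congr1 fine); rewrite -[fine _]/(\int[mu]_x (partial i (u * v) x)) pE.
rewrite RintegralD//=; [|exact: L2_integrableM|exact: L2_integrableM].
by rewrite -/(L2ip u _) -/(L2ip _ v) addrC => /eqP; rewrite addr_eq0 => /eqP.
Qed.

End test_functions.

(** * Weak gradients *)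

Section sobolev.
Context (R : realType) (d : nat).
Local Notation E := 'rV[R]_d.
Local Notation mu := (@lebesgue_rV R d).
Local Notation L2T := (@L2 R d setT).
Implicit Types (u v w : E -> R) (g h : E -> E).

Definition component (i : 'I_d) g : E -> R := fun x => g x ord0 i.

Lemma cvg_ereal0P (f : nat -> R) : (forall n, 0 <= f n) ->
  (fun n => (f n)%:E) @ \oo --> 0%E <->
  forall e, 0 < e -> \forall n \near \oo, f n < e.
Proof.
move=> f0; split=> [/fine_cvgP[_ /cvgrPdist_lt h] e /h|h].
  by apply: filterS => n /=; rewrite sub0r normrN ger0_norm.
apply/fine_cvgP; split; first exact: nearW.
apply/cvgrPdist_lt => e /h; apply: filterS => n /=.
by rewrite sub0r normrN ger0_norm.
Qed.

(** The convergence of a sequence of test functions in the definition is traded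
    for approximation within any e, in real instead of extended-real numbers;
    sums of such pairs and limits are then handled by epsilon arithmetic. *)
Lemma H10_with_gradientP omega v g : H10_with_gradient omega v g <->
  [/\ L2T v, forall i, L2T (component i g) & forall e, 0 < e ->
    exists phi, [/\ test_function omega phi, L2sq (phi - v) < e &
     forall i, L2sq (partial i phi - component i g) < e]].
Proof.
split=> [[Lv Lg [phi [tphi cphi cpphi]]]|[Lv Lg aphi]].
- split=> // e e0.
  have {}cphi : \forall n \near \oo, L2sq (phi n - v) < e.
    apply: (cvg_ereal0P _).1 => // [n|]; first exact: L2ip_ge0.
    rewrite -(_ : (fun n => \int[mu]_x ((phi n x - v x) ^+ 2)%:E)%E =
      fun n => (L2sq (phi n - v))%:E)//.
    apply/funext => n; apply: integral_sqr => //.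
    exact: test_function_L2 (tphi n).
  have {}cpphi : \forall n \near \oo, forall i,
      L2sq (partial i (phi n) - component i g) < e.
    apply: filter_forall => i.
    apply: (cvg_ereal0P _).1 => // [n|]; first exact: L2ip_ge0.
    rewrite -(_ : (fun n =>
        \int[mu]_x ((partial i (phi n) x - component i g x) ^+ 2)%:E)%E =
      fun n => (L2sq (partial i (phi n) - component i g))%:E).
      exact: cpphi.
    apply/funext => n; apply: integral_sqr; last exact: Lg.
    exact: test_function_L2 (test_function_partial i (tphi n)).
  have [n [h1 h2]] : exists n, L2sq (phi n - v) < e /\ forall i,
      L2sq (partial i (phi n) - component i g) < e.
    by near \oo => n; exists n; split; near: n.
  by exists (phi n); split.
- split=> //.
  have /choice[phi phiP] : forall n : nat, exists phi,
    [/\ test_function omega phi, L2sq (phi - v) < n.+1%:R^-1 &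
     forall i, L2sq (partial i phi - component i g) < n.+1%:R^-1].
    by move=> n; apply: aphi; rewrite invr_gt0 ltr0n.
  have tphi n : test_function omega (phi n) by have [] := phiP n.
  have small e : 0 < e -> \forall n \near \oo, n.+1%:R^-1 < e :> R.
    by move=> e0; exact: (near_infty_natSinv_lt (PosNum e0)).
  exists phi; split=> // [|i].
  + rewrite (_ : (fun n => _) = fun n => (L2sq (phi n - v))%:E); last first.
      apply/funext => n; apply: integral_sqr => //.
      exact: test_function_L2 (tphi n).
    apply/cvg_ereal0P => [n|e /small]; first exact: L2ip_ge0.
    by apply: filterS => n; apply: le_lt_trans; have [_ /ltW] := phiP n.
  + rewrite (_ : (fun n => _) = fun n =>
      (L2sq (partial i (phi n) - component i g))%:E); last first.
      apply/funext => n; apply: integral_sqr; last exact: Lg.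
      exact: test_function_L2 (test_function_partial i (tphi n)).
    apply/cvg_ereal0P => [n|e /small]; first exact: L2ip_ge0.
    apply: filterS => n; apply: le_lt_trans.
    by have [_ _ /(_ i) /ltW] := phiP n.
Unshelve. all: by end_near. Qed.

End sobolev.

Section gradient.
Context (R : realType) (d : nat).
Local Notation E := 'rV[R]_d.
Local Notation mu := (@lebesgue_rV R d).
Local Notation L2T := (@L2 R d setT).
Implicit Types (u v w : E -> R) (g h : E -> E).

Lemma component_lin i a g h :
  component i (a *: g + h) = a *: component i g + component i h.
Proof. by apply/funext => x; rewrite /component /= !mxE. Qed.

Lemma L2sq_lin_lt a u v e : 0 < e -> L2T u -> L2T v ->
  L2sq u < e / (4 * (1 + a ^+ 2)) -> L2sq v < e / 4 ->
  L2sq (a *: u + v) < e.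
Proof.
move=> e0 Lu Lv.
have a0 : 0 < 1 + a ^+ 2 by rewrite ltr_wpDr ?sqr_ge0.
rewrite ltr_pdivlMr ?mulr_gt0// => hu hv.
have := L2ip_ge0 ((- a) *: u + v).
have L1 := L2_lin a Lu Lv; have L1' := L2_lin (- a) Lu Lv.
rewrite !L2ip_linl// !L2ip_linr// (L2ipC v u).
have := L2ip_ge0 u; nra.
Qed.

Lemma H10_with_gradient_lin omega a u v g h :
  H10_with_gradient omega u g -> H10_with_gradient omega v h ->
  H10_with_gradient omega (a *: u + v) (a *: g + h).
Proof.
move=> /H10_with_gradientP[Lu Lg hu] /H10_with_gradientP[Lv Lh hv].
apply/H10_with_gradientP; split; first exact: L2_lin.
  by move=> i; rewrite component_lin; exact: L2_lin.
move=> e e0.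
have a0 : 0 < 1 + a ^+ 2 by rewrite ltr_wpDr ?sqr_ge0.
have [|phi [tphi phiu phig]] := hu (e / (4 * (1 + a ^+ 2))).
  by rewrite divr_gt0// mulr_gt0.
have [|psi [tpsi psiv psih]] := hv (e / 4); first by rewrite divr_gt0.
have Lphi := test_function_L2 tphi; have Lpsi := test_function_L2 tpsi.
exists (a *: phi + psi); split; first exact: test_function_lin.
  have -> : a *: phi + psi - (a *: u + v) = a *: (phi - u) + (psi - v).
    by rewrite scalerBr opprD addrACA.
  by apply: L2sq_lin_lt => //; exact: L2B.
move=> i; rewrite partial_lin; last 2 first.
- by move=> x; exact: test_function_derivable tphi.
- by move=> x; exact: test_function_derivable tpsi.
rewrite component_lin.
have -> : a *: partial i phi + partial i psi -
    (a *: component i g + component i h) =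
  a *: (partial i phi - component i g) + (partial i psi - component i h).
  by rewrite scalerBr opprD addrACA.
apply: L2sq_lin_lt => //; apply: L2B => //.
  exact: test_function_L2 (test_function_partial i tphi).
exact: test_function_L2 (test_function_partial i tpsi).
Qed.

Lemma H10_with_gradient0 omega : H10_with_gradient omega (0 : E -> R) 0.
Proof.
apply/H10_with_gradientP; split; first exact: L2_0.
  move=> i; rewrite (_ : component i 0 = 0); first exact: L2_0.
  by apply/funext => x; rewrite /component mxE.
have L0 := L2_0 R d.
have sq00 : L2ip (0 : E -> R) 0 = 0 by have := L2ipBl L0 L0 L0; rewrite !subrr.
move=> e e0; exists 0; split; first exact: test_function0.
  by rewrite subrr sq00.
move=> i; rewrite (_ : component i 0 = 0); last first.
  by apply/funext => x; rewrite /component mxE.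
rewrite (_ : partial i 0 = 0) ?subrr ?sq00//.
by apply/funext => x; exact: derive_cst.
Qed.

Lemma le_eps_eq0 (x C : R) : 0 <= x -> (forall e, 0 < e -> x <= C * e) -> x = 0.
Proof.
move=> x0 xe; apply/eqP; rewrite eq_le x0 andbT.
apply/ler_addgt0Pl => e e0; rewrite addr0.
have c0 : 0 < `|C| + 1 by rewrite ltr_wpDl.
apply: le_trans (xe (e / (`|C| + 1)) _) _; first by rewrite divr_gt0.
rewrite mulrCA ler_piMr ?(ltW e0)// ler_pdivrMr// mul1r.
by rewrite (le_trans (ler_norm C))// lerDl.
Qed.

(** Closability of the gradient: h is itself a limit of derivatives of test
    functions, so these derivatives serve as the functions to test against.
    For test functions chi and eta with derivatives close to h, integration by
    parts turns the pairing of these derivatives into minus the pairing of eta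
    with a second derivative of chi. Once chi is fixed, this is as small as
    desired for eta close enough to 0 in L2, while it is also close to the
    square norm of h. *)
Lemma gradient_of_zero_eq0 omega h : H10_with_gradient omega 0 h ->
  forall i, L2sq (component i h) = 0.
Proof.
move=> /H10_with_gradientP[_ Lh happrox] i.
(* |h|^2 <= 2 |g|^2 + 2 e for g = partial i chi, and |g|^2 <= 6 e *)
apply: (@le_eps_eq0 _ 14) => [|e e0]; first exact: L2ip_ge0.
have [chi [tchi _ /(_ i) chih]] := happrox _ e0.
pose g := partial i chi; pose B := L2sq (partial i g).
have tg : test_function omega g by exact: test_function_partial.
have tpg := test_function_partial i tg.
have B0 : 0 <= B by exact: L2ip_ge0.
(* The weight dl and the tolerance e * dl for eta absorb the norm B of the
   second derivative of chi, which is not controlled by e. *)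
pose dl := e / (1 + B).
have dl0 : 0 < dl by rewrite divr_gt0// ltr_wpDr.
have dlB : dl * B <= e.
  by rewrite /dl mulrAC ler_pdivrMr ?ltr_wpDr//; nra.
have edl0 : 0 < e * dl by rewrite mulr_gt0.
have [|eta [teta + /(_ i) etah]] := happrox (Num.min e (e * dl)).
  by rewrite lt_min e0.
rewrite subr0 !lt_min => /andP[_ eta0].
move: etah; rewrite lt_min => /andP[etah _].
have Lg := test_function_L2 tg; have Lpg := test_function_L2 tpg.
have Leta := test_function_L2 teta.
have Lpeta := test_function_L2 (test_function_partial i teta).
have parts := L2ip_partial_parts i teta tg.
have y1 := L2ip_young ltr01 Lg (L2B Lg Lpeta).
have y2 := L2ip_youngN dl0 Lpg Leta.
have y3 : L2sq (g - partial i eta) <= 4 * e.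
  have := L2sq_triangle (L2B Lg Lpeta) (L2B Lg (Lh i)).
  rewrite (_ : g - partial i eta - (g - component i h) =
    component i h - partial i eta); last first.
    by rewrite opprB addrC addrA subrK.
  rewrite (L2sqB_sym (component i h)); move: chih etah; rewrite -/g.
  by move: (L2ip _ _) (L2ip _ _) (L2ip _ _) => p q r; clear; lra.
have y4 : dl^-1 * L2sq eta <= e.
  by rewrite ler_pdivrMl// mulrC ltW.
have y5 := L2sq_triangle (Lh i) Lg; rewrite (L2sqB_sym (component i h)) in y5.
have y6 : L2ip g (g - partial i eta) = L2sq g + L2ip (partial i g) eta.
  by rewrite L2ipC L2ipBl// parts (L2ipC (partial i g)) opprK.
rewrite -/B in y2; rewrite invr1 !mul1r y6 in y1.
move: chih y1 y2 y3 y4 y5 dlB; rewrite -/g.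
move: (L2ip (component i h) _) (L2ip (partial i g) eta) (dl^-1 * _) (dl * B).
move: (L2ip (g - partial i eta) _) (L2ip (g - _) _) (L2sq g) => p q r; clear.
by move=> *; lra.
Qed.

Lemma H10_with_gradient_uniq omega v g h :
  H10_with_gradient omega v g -> H10_with_gradient omega v h ->
  {ae mu, forall x, g x = h x}.
Proof.
move=> vg vh; have := H10_with_gradient_lin (- 1) vg vh.
rewrite scaleN1r addNr => d0.
have : {ae mu, forall x, forall i, component i (- 1 *: g + h) x = 0}.
  apply: filter_forall => i.
  apply: L2sq0_ae; last exact: gradient_of_zero_eq0 d0 i.
  by have [_ + _] := d0; exact.
apply: filterS => x gh; apply/rowP => i; have := gh i.
by rewrite /component /= !mxE mulN1r addrC => /eqP; rewrite subr_eq0 => /eqP.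
Qed.

Lemma H10_gradient omega v : H10 omega v ->
  H10_with_gradient omega v (gradient omega v).
Proof. by move=> [g vg]; rewrite /gradient; case: xgetP => [h ->|/(_ g)]. Qed.

Lemma gradient_lin omega a u v : H10 omega u -> H10 omega v ->
  {ae mu, forall x, gradient omega (a *: u + v) x =
    a *: gradient omega u x + gradient omega v x}.
Proof.
move=> Hu Hv.
have Huv := H10_with_gradient_lin a (H10_gradient Hu) (H10_gradient Hv).
apply: (H10_with_gradient_uniq (H10_gradient _) Huv).
by exists (a *: gradient omega u + gradient omega v).
Qed.

Lemma H10_lin omega a u v :
  H10 omega u -> H10 omega v -> H10 omega (a *: u + v).
Proof.
move=> [g ug] [h vh]; exists (a *: g + h).
exact: H10_with_gradient_lin.
Qed.

Lemma H10_0 omega : H10 omega (0 : E -> R).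
Proof. by exists 0; exact: H10_with_gradient0. Qed.

End gradient.

(** * The Poincare inequality *)

Section poincare.
Context (R : realType) (d : nat).
Local Notation E := 'rV[R]_d.
Local Notation mu := (@lebesgue_rV R d).
Local Notation L2T := (@L2 R d setT).

Lemma partial_coordinate (i : 'I_d) (x : E) :
  derivable (fun y : E => y ord0 i) x (delta_mx ord0 i) /\
  'D_(delta_mx ord0 i) (fun y : E => y ord0 i) x = 1.
Proof.
have line (h : R) : (h *: delta_mx ord0 i + x : E) ord0 i = h *: 1 + x ord0 i.
  by rewrite !mxE !eqxx.
split; first exact: (derivable_comp_line line (@derivable_id _ _ _ _)).
by rewrite (derive_comp_line id line) derive_id.
Qed.

(** Integrate the i-th derivative of x_i phi^2, which is
    phi^2 + 2 x_i phi (partial i phi), and absorb half of the square norm of phi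
    by Young's inequality. *)
Lemma poincare omega (phi : E -> R) i (K : R) : test_function omega phi ->
  (forall x, omega x -> `|x ord0 i| <= K) ->
  L2sq phi <= 4 * K ^+ 2 * L2sq (partial i phi).
Proof.
move=> tphi oK.
pose c (x : E) : R := x ord0 i.
have cc : continuous c by exact: coord_continuous.
have cphi := test_function_continuous tphi.
have tp := test_function_partial i tphi.
have cp := test_function_continuous tp.
have [M phiM] := test_function_support tphi.
have [N pN] := test_function_support tp.
have Lphi := test_function_L2 tphi.
have Lp := test_function_L2 tp.
have Lcp : L2T (c * partial i phi).
  apply: (@continuous_support_L2 _ _ _ N).
    by move=> x; apply: continuousM; [exact: cc|exact: cp].
  by move=> x /pN px; rewrite [LHS](_ : _ = c x * partial i phi x)// px mulr0.
have pE : partial i (c * (phi * phi)) =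
    phi * phi + 2 *: (phi * (c * partial i phi)).
  apply/funext => x.
  have [dc pc] : derivable c x (delta_mx ord0 i) /\ partial i c x = 1.
    exact: partial_coordinate.
  have dphi : derivable phi x (delta_mx ord0 i).
    exact: test_function_derivable tphi.
  rewrite (partialM dc (derivableM dphi dphi)) (partialM dphi dphi).
  rewrite pc [phi * phi + _]addrC fct_linE !fctME.
  by move: (partial i phi x) => D; ring.
have int0 : \int[mu]_x partial i (c * (phi * phi)) x = 0.
  have : (\int[mu]_x (partial i (c * (phi * phi)) x)%:E = 0)%E.
    apply: (@integral_partial_eq0 _ _ i _ M).
    - move=> x; apply: continuousM; first exact: cc.
      by apply: continuousM; exact: cphi.
    - move=> x; have [dc _] := partial_coordinate i x.
      have dphi : derivable phi x (delta_mx ord0 i).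
        exact: test_function_derivable tphi.
      exact: (derivableM dc (derivableM dphi dphi)).
    - rewrite pE => x; apply: continuousD.
        by apply: continuousM; exact: cphi.
      apply: continuousZr; apply: continuousM; first exact: cphi.
      by apply: continuousM; [exact: cc|exact: cp].
    - move=> x /phiM px; rewrite [LHS](_ : _ = c x * (phi x * phi x))//.
      by rewrite px !mulr0.
  by move/(congr1 fine).
have sum0 : L2sq phi + 2 * L2ip phi (c * partial i phi) = 0.
  rewrite -int0 pE /L2ip -RintegralZl//; last exact: L2_integrableM.
  rewrite -RintegralD//; first exact: L2_integrableM.
  exact: (integrableZl measurableT 2 (L2_integrableM Lphi Lcp)).
have half0 : 0 < 2^-1 :> R by rewrite invr_gt0.
have := L2ip_youngN half0 Lphi Lcp; rewrite invrK => y.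
have bound : L2sq (c * partial i phi) <=
    K ^+ 2 * L2sq (partial i phi).
  rewrite /L2ip -RintegralZl//; last exact: L2_integrableM.
  apply: le_Rintegral => //; first exact: L2_integrableM.
    exact: (integrableZl measurableT (K ^+ 2) (L2_integrableM Lp Lp)).
  move=> x _.
  change (c x * partial i phi x * (c x * partial i phi x) <=
    K ^+ 2 * (partial i phi x * partial i phi x)).
  have [xo|xo] := pselect (omega x).
    rewrite mulrACA -!expr2 ler_wpM2r ?sqr_ge0//.
    have := oK x xo; rewrite -/(c x) ler_norml => /andP[h1 h2].
    rewrite -ler_sqrt ?sqr_ge0// !sqrtr_sqr.
    by rewrite (le_trans _ (ler_norm _))// ler_norml h1.
  suff -> : partial i phi x = 0 by rewrite !mulr0.
  have [_ [L [_ Lo pL]]] := tp.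
  by apply: pL => /Lo.
lra.
Qed.

End poincare.

(** * The elliptic form *)

Section elliptic_form.
Context (R : realType) (d : nat).
Local Notation E := 'rV[R]_d.
Local Notation mu := (@lebesgue_rV R d).
Local Notation L2T := (@L2 R d setT).
Context (Omega : set E) (alpha beta : R) (A : E -> 'M[R]_d).
Hypotheses (Omega_open : open Omega) (A_coef : coefficient Omega alpha beta A).
Implicit Types (u v w : E -> R) (g h : E -> E) (T : set E).

Let mOmega : measurable Omega := open_measurable_rV Omega_open.

Lemma dotDZl (a : R) (x y z : E) : dot (a *: x + y) z = a * dot x z + dot y z.
Proof.
rewrite /dot mulr_sumr -big_split; apply: eq_bigr => i _.
by rewrite !mxE mulrDl mulrA.
Qed.

Lemma dotC (x y : E) : dot x y = dot y x.
Proof. by apply: eq_bigr => i _; rewrite mulrC. Qed.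

Lemma mxact_lin (B : 'M[R]_d) (a : R) (x y : E) :
  mxact B (a *: x + y) = a *: mxact B x + mxact B y.
Proof. by rewrite /mxact linearP /= mulmxDr -scalemxAr linearP. Qed.

Lemma integrable_Linfty_mul T a (f : E -> R) : measurable T -> T `<=` Omega ->
  Linfty Omega a -> mu.-integrable T (EFin \o f) ->
  mu.-integrable T (EFin \o (fun x => a x * f x)).
Proof.
move=> mT TO [ma [C aC]] intf.
have mf : measurable_fun T f.
  by apply/measurable_EFinP; exact: measurable_int intf.
have maf : measurable_fun T (fun x => a x * f x).
  by apply: measurable_funM => //; exact: measurable_funS ma.
apply/integrableP; split; first exact/measurable_EFinP.
have /integrableP[_] := integrableZl mT `|C| intf.
apply: le_lt_trans; apply: ae_ge0_le_integral => //.
- by apply: measurableT_comp => //; exact/measurable_EFinP.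
- apply: measurableT_comp => //; apply/measurable_EFinP.
  exact: measurable_funM.
apply: filterS aC => x aC Tx /=.
rewrite lee_fin !normrM normr_id ler_wpM2r//.
by rewrite (le_trans (aC (TO _ Tx)))// ler_norm.
Qed.

Lemma integrable_form T g h : measurable T -> T `<=` Omega ->
  (forall i, L2T (component i g)) -> (forall i, L2T (component i h)) ->
  mu.-integrable T (EFin \o (fun x => dot (mxact (A x) (g x)) (h x))).
Proof.
move=> mT TO Lg Lh.
rewrite (_ : EFin \o _ = fun x =>
  (\sum_(i < d) \sum_(j < d)
     (A x i j * (component j g x * component i h x))%:E)%E).
  apply: integrable_sum => // i _; apply: integrable_sum => // j _.
  have [LA _ _] := A_coef.
  apply: (integrable_Linfty_mul mT TO (LA i j)).
  by apply: (integrableS measurableT) => //; exact: L2_integrableM.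
apply/funext => x /=; rewrite /dot -sumEFin; apply: eq_bigr => i _.
rewrite sumEFin /mxact !mxE mulr_suml; congr EFin; apply: eq_bigr => j _.
by rewrite !mxE mulrA.
Qed.

Lemma gradient_L2 v :
  H10 Omega v -> forall i, L2T (component i (gradient Omega v)).
Proof. by move=> /H10_gradient[]. Qed.

Lemma Rintegral_ae_lin T (a : R) (f f1 f2 : E -> R) : measurable T ->
  mu.-integrable T (EFin \o f) -> mu.-integrable T (EFin \o f1) ->
  mu.-integrable T (EFin \o f2) ->
  {ae mu, forall x, f x = a * f1 x + f2 x} ->
  Rintegral mu T f = a * Rintegral mu T f1 + Rintegral mu T f2.
Proof.
move=> mT if0 if1 if2 fE; have iaf1 := integrableZl mT a if1.
rewrite -RintegralZl// -RintegralD//.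
congr fine; apply: ae_eq_integral => //.
- exact: measurable_int if0.
- exact: measurable_int (integrableD mT iaf1 if2).
by apply: filterS fE => x fE _; rewrite fE.
Qed.

Lemma bil_on_linl T a u v w : measurable T -> T `<=` Omega ->
  H10 Omega u -> H10 Omega v -> H10 Omega w ->
  bil_on Omega A T (a *: u + v) w =
  a * bil_on Omega A T u w + bil_on Omega A T v w.
Proof.
move=> mT TO Hu Hv Hw.
have I := fun z (Hz : H10 Omega z) =>
  integrable_form mT TO (gradient_L2 Hz) (gradient_L2 Hw).
have Huw := I _ Hu; have Hvw := I _ Hv; have Huvw := I _ (H10_lin a Hu Hv).
apply: (Rintegral_ae_lin mT Huvw Huw Hvw).
apply: filterS (gradient_lin a Hu Hv) => x uvx.
by rewrite uvx mxact_lin dotDZl.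
Qed.

Lemma bil_on_linr T a u v w : measurable T -> T `<=` Omega ->
  H10 Omega u -> H10 Omega v -> H10 Omega w ->
  bil_on Omega A T w (a *: u + v) =
  a * bil_on Omega A T w u + bil_on Omega A T w v.
Proof.
move=> mT TO Hu Hv Hw.
have I := fun z (Hz : H10 Omega z) =>
  integrable_form mT TO (gradient_L2 Hw) (gradient_L2 Hz).
have Huw := I _ Hu; have Hvw := I _ Hv; have Huvw := I _ (H10_lin a Hu Hv).
apply: (Rintegral_ae_lin mT Huvw Huw Hvw).
apply: filterS (gradient_lin a Hu Hv) => x uvx.
by rewrite uvx dotC dotDZl !(dotC _ (mxact _ _)).
Qed.

(** By ellipticity the gradient g of v vanishes on Omega. Outside Omega the
    derivatives of the approximating test functions phi vanish, so these
    derivatives tend to 0 in L2(R^d); by the Poincare inequality phi, hence v,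
    is 0 in the limit. *)
Lemma bil_definite v : 0 < alpha -> (0 < d)%N -> bounded_set Omega ->
  H10 Omega v -> bil Omega A v v = 0 -> L2sq v = 0.
Proof.
move=> alpha0 d0 bO Hv Av0; pose i : 'I_d := Ordinal d0.
have [K OK] : exists K : R, forall x, Omega x -> `|x ord0 i| <= K.
  have [M [_ MO]] := bO; exists (M + 1) => x Ox.
  by apply: le_trans (ler_rV_coord x i) (MO _ _ _ Ox); rewrite ltrDl.
pose g := gradient Omega v.
have [Lv Lg approx] := (H10_with_gradientP _ _ _).1 (H10_gradient Hv).
have ig := L2_integrableM (Lg i) (Lg i).
have igO : mu.-integrable Omega
    (EFin \o (fun x => component i g x * component i g x)).
  exact: integrableS ig.
have gO : \int[mu]_(x in Omega) (component i g x * component i g x) = 0.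
  apply/eqP; rewrite eq_le; apply/andP; split; last first.
    by apply: Rintegral_ge0 => x _; rewrite -expr2 sqr_ge0.
  rewrite -(pmulr_rle0 _ alpha0) -RintegralZl// -[leRHS]Av0.
  apply: le_Rintegral => //; first exact: (integrableZl mOmega alpha igO).
    exact: integrable_form.
  move=> x Ox; have [_ _ /(_ x (g x) Ox) /andP[+ _]] := A_coef.
  rewrite dotC; apply: le_trans; rewrite ler_pM2l//.
  have dot_ge0 (y : E) : 0 <= dot y y.
    by apply: sumr_ge0 => j _; rewrite -expr2 sqr_ge0.
  rewrite /enorm sqr_sqrtr// /dot (bigD1 i)//= lerDl.
  by apply: sumr_ge0 => j _; rewrite -expr2 sqr_ge0.
(* |v|^2 <= 2 |phi|^2 + 2 e and |phi|^2 <= 4 K^2 |partial i phi|^2 <= 8 K^2 e *)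
apply: (@le_eps_eq0 _ _ (16 * K ^+ 2 + 2)) => [|e e0]; first exact: L2ip_ge0.
have [phi [tphi phiv /(_ i) phig]] := approx e e0.
have tp := test_function_partial i tphi.
have Lphi := test_function_L2 tphi; have Lp := test_function_L2 tp.
have iD := L2_integrableM (L2B Lp (Lg i)) (L2B Lp (Lg i)).
have igT : mu.-integrable setT
    (EFin \o ((fun x => component i g x * component i g x) \_ Omega)).
  by rewrite -restrict_EFin; exact: (integrable_mkcond _ mOmega).1 igO.
have pp : L2sq (partial i phi) <= 2 * e.
  suff : L2sq (partial i phi) <= 2 * L2sq (partial i phi - component i g)
      + 2 * \int[mu]_(x in Omega) (component i g x * component i g x).
    by move=> /le_trans; apply; rewrite gO mulr0 addr0 ler_pM2l// ltW.
  rewrite Rintegral_mkcond /L2ip -!RintegralZl// -RintegralD//; last 2 first.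
  - exact: (integrableZl measurableT 2 iD).
  - exact: (integrableZl measurableT 2 igT).
  apply: le_Rintegral => //; first exact: L2_integrableM.
    exact: (integrableD measurableT (integrableZl measurableT 2 iD)
      (integrableZl measurableT 2 igT)).
  (* |p|^2 <= 2 |p - q|^2 + 2 |q|^2 on Omega, and p = 0 outside Omega *)
  move=> x _ /=; rewrite fctBE patchE; case: ifPn => [_|].
    move: (partial i phi x) (component i g x) => p q.
    by have := sqr_ge0 (p - 2 * q); nra.
  rewrite notin_setE => xO; suff -> : partial i phi x = 0.
    rewrite mul0r; apply: addr_ge0; last by rewrite [X in 0 <= X]mulr0.
    by rewrite mulr_ge0 // -expr2 sqr_ge0.
  by have [_ [L [_ Lo pL]]] := tp; apply: pL => /Lo.
have := poincare tphi OK; have := L2sq_triangle Lv Lphi; rewrite L2sqB_sym.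
move: phiv pp; have := L2ip_ge0 (partial i phi).
move: (L2ip (partial i phi) _) (L2ip (phi - v) _) (L2sq phi) (L2sq v).
move=> p q r s.
by have := sqr_ge0 K; move: (K ^+ 2) e0; clear; move=> *; nra.
Qed.

End elliptic_form.

(** * Nondegenerate forms on finite-dimensional spaces *)

Section finite_dimensional_solve.
Context (F : fieldType) (V : lmodType F).

Definition lin_subspace (W : set V) :=
  W 0 /\ forall c u v, W u -> W v -> W (c *: u + v).

Definition linear_on (W : set V) (l : V -> F) :=
  forall c u v, W u -> W v -> l (c *: u + v) = c * l u + l v.

Definition bilinear_on (W : set V) (b : V -> V -> F) :=
  forall w, W w -> linear_on W (b w) /\ linear_on W (b^~ w).

Definition finitely_spanned (W : set V) := exists n (b : 'I_n -> V),
  forall w, W w -> exists c : 'I_n -> F, w = \sum_i c i *: b i.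

Lemma linear_on0 W l : lin_subspace W -> linear_on W l -> l 0 = 0.
Proof.
move=> [W0 _] l_lin; have := l_lin 1 0 0 W0 W0.
by rewrite scaler0 addr0 mul1r => /eqP; rewrite -subr_eq subrr => /eqP.
Qed.

Context (W : set V).
Hypotheses (W_subspace : lin_subspace W) (W_fin : finitely_spanned W).

Lemma linear_on_sum (f : V -> F) m (e : 'I_m -> V) (c : 'I_m -> F) :
  linear_on W f -> (forall i, W (e i)) ->
  W (\sum_i c i *: e i) /\ f (\sum_i c i *: e i) = \sum_i c i * f (e i).
Proof.
move=> f_lin We; have [W0 W_lin] := W_subspace.
elim/big_rec2 : _ => [|i y x _ [Wx <-]].
  by rewrite (linear_on0 W_subspace).
by split; [exact: W_lin|rewrite f_lin].
Qed.

Definition free_family m (e : 'I_m -> V) :=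
  forall c : 'I_m -> F, \sum_i c i *: e i = 0 -> forall i, c i = 0.

(** A free family in W with the largest number of vectors spans W: otherwise a
    vector outside its span could be added. The number is bounded because the
    coordinate matrix of a free family on a spanning family of n vectors is row
    free, so of rank at most n. *)
Lemma subspace_basis : exists m (e : 'I_m -> V),
  [/\ forall i, W (e i), free_family e &
    forall w, W w -> exists c : 'I_m -> F, w = \sum_i c i *: e i].
Proof.
have [n [b Wb]] := W_fin.
pose P m := `[< exists e : 'I_m -> V, (forall i, W (e i)) /\ free_family e >].
have P0 : exists m, P m.
  exists 0%N; apply/asboolP; exists (fun=> 0).
  by split=> [[]|c _ []].
have Pn m : P m -> (m <= n)%N.
  move=> /asboolP[e [We free_e]].
  have /choice[M eM] := fun i => Wb _ (We i).
  pose MM := \matrix_(i < m, j < n) M i j.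
  suff /eqP <- : row_free MM by exact: rank_leq_col.
  apply: inj_row_free => x xM; apply/rowP => i; rewrite mxE.
  apply: (free_e (fun i => x ord0 i)).
  under eq_bigr do rewrite eM scaler_sumr.
  rewrite exchange_big big1// => j _.
  under eq_bigr do rewrite scalerA.
  have xMj : \sum_(i < m) x ord0 i * M i j = 0.
    have /rowP/(_ j) := xM; rewrite !mxE => xMj; rewrite -[RHS]xMj.
    by apply: eq_bigr => k _; rewrite mxE.
  by rewrite -scaler_suml xMj scale0r.
case: (ex_maxnP P0 Pn) => m /asboolP[e [We free_e]] m_max.
exists m, e; split=> // w Ww; apply: contrapT => w_notin.
suff /m_max : P m.+1 by rewrite ltnn.
apply/asboolP; exists (fun i => oapp e w (unlift ord0 i)); split.
  by move=> i; case: unliftP => [j|] _ /=.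
move=> c; rewrite big_ord_recl unlift_none /=.
under eq_bigr do rewrite liftK /=.
move=> c0.
have c00 : c ord0 = 0.
  apply: contrapT => /eqP c00; apply: w_notin.
  exists (fun i => - (c ord0)^-1 * c (lift ord0 i)).
  under eq_bigr do rewrite -scalerA.
  rewrite -scaler_sumr; move/eqP: c0; rewrite addrC addr_eq0 => /eqP ->.
  by rewrite scalerN scaleNr opprK scalerA mulVf// scale1r.
move: c0; rewrite c00 scale0r add0r => /free_e ce i.
by case: (unliftP ord0 i) => [j|] ->.
Qed.

(** Nondegeneracy on the left makes the Gram matrix of a basis row free, hence
    invertible, and the solution is read off in coordinates. *)
Lemma nondegenerate_solve (B : V -> V -> F) (l : V -> F) :
  bilinear_on W B -> linear_on W l ->
  (forall w, W w -> (forall v, W v -> B w v = 0) -> w = 0) ->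
  exists w, W w /\ forall v, W v -> B w v = l v.
Proof.
move=> B_bil l_lin B_nondeg.
have [m [e [We free_e span_e]]] := subspace_basis.
pose G := \matrix_(i < m, j < m) B (e i) (e j).
have comb (x : 'rV[F]_m) j : W (\sum_i x ord0 i *: e i) /\
    B (\sum_i x ord0 i *: e i) (e j) = (x *m G) ord0 j.
  have [_ B_linl] := B_bil _ (We j).
  have [Wx Bx] := linear_on_sum (fun i => x ord0 i) B_linl We.
  by split=> //; rewrite Bx mxE; apply: eq_bigr => i _; rewrite mxE.
have test w f : W w -> linear_on W f -> (forall j, B w (e j) = f (e j)) ->
    forall v, W v -> B w v = f v.
  move=> Ww f_lin wf v Wv; have [c ->] := span_e v Wv.
  have [B_linr _] := B_bil _ Ww.
  have [_ ->] := linear_on_sum c f_lin We.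
  have [_ ->] := linear_on_sum c B_linr We.
  by apply: eq_bigr => j _; rewrite wf.
have Gu : G \in unitmx.
  rewrite -row_free_unit; apply: inj_row_free => x xG.
  apply/rowP => i; rewrite mxE; apply: (free_e (fun i => x ord0 i)).
  have [Wx _] := comb x i.
  apply: B_nondeg => // v Wv; apply: (test _ (fun=> 0) Wx) => //.
    by move=> *; rewrite mulr0 addr0.
  by move=> j; have [_ ->] := comb x j; rewrite xG mxE.
pose x := (\row_j l (e j)) *m invmx G.
have Wx : W (\sum_i x ord0 i *: e i).
  exact: (linear_on_sum (fun i => x ord0 i) l_lin We).1.
exists (\sum_i x ord0 i *: e i); split=> //; apply: test => // j.
by have [_ ->] := comb x j; rewrite /x mulmxKV// mxE.
Qed.

End finite_dimensional_solve.

(** * The two-scale system for abstract forms *)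

Section two_scale_algebra.
Context (F : fieldType) (V : lmodType F).

Lemma subspaceB (W : set V) u v : lin_subspace W -> W u -> W v -> W (u - v).
Proof.
move=> [_ W_lin] Wu Wv; have := W_lin (-1) v u Wv Wu.
by rewrite scaleN1r addrC.
Qed.

Lemma subspace_sum (W : set V) n (u : 'I_n -> V) :
  lin_subspace W -> (forall i, W (u i)) -> W (\sum_i u i).
Proof.
move=> [W0 W_lin] Wu; elim/big_ind : _ => // v w Wv Ww.
by rewrite -[v]scale1r; exact: W_lin.
Qed.

Lemma linear_onB (W : set V) (l : V -> F) u v :
  lin_subspace W -> linear_on W l -> W u -> W v -> l (u - v) = l u - l v.
Proof.
move=> sW l_lin Wu Wv; have := l_lin (-1) v u Wv Wu.
by rewrite scaleN1r addrC => ->; rewrite mulN1r addrC.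
Qed.

Context (N : nat) (Vh VH : set V) (Vf : 'I_N -> set V).
Context (a : V -> V -> F) (aT : 'I_N -> V -> V -> F) (l : V -> F).
Hypotheses (Vh_subspace : lin_subspace Vh) (VH_subspace : lin_subspace VH)
  (Vf_subspace : forall i, lin_subspace (Vf i)).
Hypotheses (VH_Vh : VH `<=` Vh) (Vf_Vh : forall i, Vf i `<=` Vh).
Hypothesis Vh_fin : finitely_spanned Vh.
Hypotheses (a_bil : bilinear_on Vh a)
  (aT_bil : forall i, bilinear_on Vh (aT i)).
Hypothesis l_lin : linear_on Vh l.
Hypothesis a_definite : forall u, Vh u -> a u u = 0 -> u = 0.

Let sub_fin W : W `<=` Vh -> finitely_spanned W.
Proof. by have [n [b Vb]] := Vh_fin => WV; exists n, b => w /WV /Vb. Qed.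

Definition is_corrector i u q := Vf i q /\ forall w, Vf i w -> a q w = aT i u w.

(** Lax-Milgram in finite dimension: a definite form is nondegenerate. *)
Lemma corrector_exists i u : Vh u -> exists q, is_corrector i u q.
Proof.
move=> Vu; apply: (nondegenerate_solve (Vf_subspace i) (sub_fin (@Vf_Vh i))).
- move=> w /Vf_Vh/a_bil[a_linr a_linl].
  by split=> c v z /Vf_Vh Vv /Vf_Vh Vz; [exact: a_linr|exact: a_linl].
- move=> c v w /Vf_Vh Vv /Vf_Vh Vw; have [aT_linr _] := aT_bil i Vu.
  exact: aT_linr.
- by move=> w Ww ww0; apply: a_definite; [exact: Vf_Vh Ww|exact: ww0].
Qed.

Lemma is_corrector_uniq i u q1 q2 :
  is_corrector i u q1 -> is_corrector i u q2 -> q1 = q2.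
Proof.
move=> [V1 q1P] [V2 q2P]; have V12 := subspaceB (Vf_subspace i) V1 V2.
apply/eqP; rewrite -subr_eq0; apply/eqP.
apply: a_definite; first exact: Vf_Vh V12.
have [_ a_linl] := a_bil (Vf_Vh V12).
rewrite (linear_onB Vh_subspace a_linl (Vf_Vh V1) (Vf_Vh V2)).
by rewrite q1P// q2P// subrr.
Qed.

Lemma is_corrector_lin i c u v q r : Vh u -> Vh v ->
  is_corrector i u q -> is_corrector i v r ->
  is_corrector i (c *: u + v) (c *: q + r).
Proof.
move=> Vu Vv [Vq qP] [Vr rP]; split; first exact: (Vf_subspace i).2.
move=> w Vw; have Vhw := Vf_Vh Vw.
have [_ a_linl] := a_bil Vhw; have [_ aT_linl] := aT_bil i Vhw.
by rewrite a_linl ?aT_linl ?qP ?rP//; exact: (@Vf_Vh i).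
Qed.

Context (Q : 'I_N -> V -> V).
Hypothesis QP : forall i u, Vh u -> is_corrector i u (Q i u).

Let ms u := u - \sum_i Q i u.

Let ms_Vh u : Vh u -> Vh (ms u).
Proof.
move=> Vu; apply: (subspaceB Vh_subspace Vu).
apply: (subspace_sum Vh_subspace) => i.
by have [/Vf_Vh] := QP i Vu.
Qed.

Let ms_lin c u v : Vh u -> Vh v -> ms (c *: u + v) = c *: ms u + ms v.
Proof.
move=> Vu Vv; rewrite /ms scalerBr addrACA -opprD; congr (_ - _).
rewrite scaler_sumr -big_split; apply: eq_bigr => i _.
apply: (is_corrector_uniq (QP i _)); first exact: Vh_subspace.2.
by apply: is_corrector_lin => //; exact: QP.
Qed.

Hypothesis VH_nondegenerate :
  forall w, VH w -> (forall v, VH v -> a (w - \sum_i Q i w) v = 0) -> w = 0.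

(** In finite dimension, injectivity of the map that sends w to the functional
    v |-> a (w - sum_i Q i w) v is also surjectivity. *)
Lemma coarse_solution_exists :
  exists u, VH u /\ forall v, VH v -> a (u - \sum_i Q i u) v = l v.
Proof.
apply: (nondegenerate_solve VH_subspace (sub_fin VH_Vh)
  (B := fun u v => a (ms u) v)).
- move=> w /VH_Vh Vw; split=> c u v /VH_Vh Vu /VH_Vh Vv.
    by have [a_linr _] := a_bil (ms_Vh Vw); rewrite a_linr.
  have [_ a_linl] := a_bil Vw.
  by rewrite ms_lin// a_linl//; exact: ms_Vh.
- by move=> c u v /VH_Vh ? /VH_Vh ?; exact: l_lin.
- exact: VH_nondegenerate.
Qed.

Lemma coarse_solution_uniq u1 u2 : VH u1 -> VH u2 ->
  (forall v, VH v -> a (ms u1) v = a (ms u2) v) -> u1 = u2.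
Proof.
move=> V1 V2 u12; apply/eqP; rewrite -subr_eq0; apply/eqP.
apply: VH_nondegenerate; first exact: subspaceB.
move=> v Vv; have [_ a_linl] := a_bil (VH_Vh Vv).
rewrite -/(ms (u1 - u2)).
have -> : u1 - u2 = (-1) *: u2 + u1 by rewrite scaleN1r addrC.
have [Vh1 Vh2] := (VH_Vh V1, VH_Vh V2).
rewrite ms_lin// a_linl; [|exact: ms_Vh|exact: ms_Vh].
by rewrite u12// mulN1r addNr.
Qed.

(** A solution is tested first with (0, w in the i-th slot), which isolates the
    i-th corrector problem and forces the i-th fine component to be the
    corrector of the coarse one, and then with (v, 0), which leaves the coarse
    problem. *)
Lemma two_scale_characterization (r : F) (uH : V) (u : V * ('I_N -> V)) :
  r != 0 -> VH uH -> (forall v, VH v -> a (uH - \sum_i Q i uH) v = l v) ->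
  ((VH u.1 /\ forall i, Vf i (u.2 i)) /\
   forall v : V * ('I_N -> V), (VH v.1 /\ forall i, Vf i (v.2 i)) ->
     a (u.1 - \sum_i u.2 i) v.1 +
     r * \sum_i (a (u.2 i) (v.2 i) - aT i u.1 (v.2 i)) = l v.1) <->
  u = (uH, fun i => Q i uH).
Proof.
move=> r0 VuH uHP; have [VH0 _] := VH_subspace.
have Vf0 i : Vf i 0 by have [] := Vf_subspace i.
have a0 w : Vh w -> a w 0 = 0.
  by move=> /a_bil[a_linr _]; exact: linear_on0 Vh_subspace a_linr.
have aT0 i w : Vh w -> aT i w 0 = 0.
  by move=> /(aT_bil i)[a_linr _]; exact: linear_on0 Vh_subspace a_linr.
split=> [|->]; last first.
  split=> [|v [Vv1 Vv2]].
    by split=> //= i; have [] := QP i (VH_Vh VuH).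
  rewrite /= [X in r * X]big1 ?mulr0 ?addr0; first exact: uHP.
  by move=> i _; have [_ ->] := QP i (VH_Vh VuH); rewrite ?subrr.
case: u => vH vf /= [[VvH Vvf] sol].
have VhvH := VH_Vh VvH.
have vfE : vf = fun i => Q i vH.
  apply/funext => i; apply: (is_corrector_uniq _ (QP i VhvH)).
  split=> // w Vw.
  pose v := (0 : V, fun j => if j == i then w else 0).
  have Vv : VH v.1 /\ forall j, Vf j (v.2 j).
    by split=> //= j; case: eqP => [->|].
  have := sol v Vv.
  rewrite /= (linear_on0 Vh_subspace l_lin) a0 ?add0r; last first.
    apply: (subspaceB Vh_subspace VhvH); apply: (subspace_sum Vh_subspace) => j.
    exact: Vf_Vh (Vvf j).
  rewrite (bigD1 i)//= eqxx big1 ?addr0 => [|j /negPf ->]; last first.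
    by rewrite a0 ?aT0 ?subrr//; exact: Vf_Vh (Vvf j).
  by move/eqP; rewrite mulf_eq0 (negPf r0) subr_eq0 => /eqP.
suff <- : vH = uH by rewrite vfE.
apply: coarse_solution_uniq => // v Vv; rewrite [RHS]uHP//.
have := sol (v, fun=> 0) (conj Vv Vf0); rewrite /= [X in r * X]big1 => [|i _].
  by rewrite mulr0 addr0 vfE.
by rewrite a0 ?aT0 ?subrr//; exact: Vf_Vh (Vvf i).
Qed.

End two_scale_algebra.

(** * The two-scale system of the PG-LOD method *)

Section pglod.
Context (R : realType) (d : nat) (Omega : set 'rV[R]_d) (alpha beta : R).
Local Notation E := 'rV[R]_d.
Local Notation mu := (@lebesgue_rV R d).
Context (A : E -> 'M[R]_d) (f : E -> R).
Context (M N : nat) (Th : 'I_M -> set E) (TH : 'I_N -> set E).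
Context (Vh : set (E -> R)) (C_IH : R) (IH : (E -> R) -> E -> R) (k : nat).
Hypotheses (d_gt0 : (0 < d)%N) (alpha_gt0 : 0 < alpha).
Hypotheses (Omega_open : open Omega) (Omega_bnd : bounded_set Omega).
Hypotheses (A_coef : coefficient Omega alpha beta A) (f_L2 : L2 Omega f).
Hypotheses (Vh_fe : conforming_fe_space Omega Th Vh).
Hypotheses (TH_mesh : is_mesh Omega TH).
Hypotheses (IH_qi : quasi_interpolation Omega TH Vh C_IH IH).

Local Notation VH := (VH Omega TH Vh).
Local Notation VfT := (VfT TH Vh IH k).
Local Notation a := (bil Omega A).
Local Notation aT i := (bil_on Omega A (TH i)).
Local Notation Q := (corrector_on Omega TH Vh IH k A).
Local Notation Qsum := (corrector Omega TH Vh IH k A).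

Lemma Vh_subspace : lin_subspace Vh.
Proof.
have [[n [b ->]] _ _] := Vh_fe; split.
  by exists (fun=> 0); rewrite big1// => i _; rewrite scale0r.
move=> c _ _ [x ->] [y ->]; exists (fun i => c * x i + y i).
rewrite scaler_sumr -big_split; apply: eq_bigr => i _ /=.
by rewrite scalerA scalerDl.
Qed.

Lemma Vh_H10 u : Vh u -> H10 Omega u.
Proof. by have [_ + _] := Vh_fe; exact. Qed.

(** Elements of the finite-element space are continuous representatives, so
    vanishing almost everywhere is vanishing. *)
Lemma Vh_definite u : Vh u -> a u u = 0 -> u = 0.
Proof.
move=> Vu au0; have Hu := Vh_H10 Vu.
have uu0 := bil_definite Omega_open A_coef alpha_gt0 d_gt0 Omega_bnd Hu au0.
apply: continuous_ae0; first by have [_ _ /(_ u Vu)[]] := Vh_fe.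
by apply: L2sq0_ae => //; have [] := H10_gradient Hu.
Qed.

Lemma VH_Vh u : VH u -> Vh u. Proof. by case. Qed.

Lemma VH_subspace : lin_subspace VH.
Proof.
have cVh u : Vh u -> {within Omega, continuous u}.
  by move=> Vu; apply: continuous_subspaceT; have [_ _ /(_ u Vu)[]] := Vh_fe.
have V0 := Vh_subspace.1.
split.
  split=> //; split; first exact: cVh.
  move=> i; exists 0, 0 => x _.
  by rewrite /dot addr0 big1// => j _; rewrite mxE mul0r.
move=> c u v [Vu [_ Pu]] [Vv [_ Pv]].
have Vuv := Vh_subspace.2 c u v Vu Vv.
split=> //; split; first exact: cVh.
move=> i; have [b1 [c1 ub]] := Pu i; have [b2 [c2 vb]] := Pv i.
exists (c *: b1 + b2), (c * c1 + c2) => x Tx.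
by rewrite fct_linE ub// vb// dotDZl; ring.
Qed.

Lemma VfT_Vh i u : VfT i u -> Vh u. Proof. by case=> -[]. Qed.

Lemma VfT_subspace i : lin_subspace (VfT i).
Proof.
have V0 := Vh_subspace.1.
have [_ IH_lin _ _] := IH_qi.
split.
  split; last exact: H10_0.
  split=> //; have := IH_lin 1 0 0 V0 V0.
  by rewrite scaler0 addr0 scale1r => /eqP; rewrite -subr_eq subrr => /eqP.
move=> c u v [[Vu Iu] Hu] [[Vv Iv] Hv]; split; last exact: H10_lin.
split; first exact: Vh_subspace.2.
by rewrite IH_lin// Iu Iv scaler0 addr0.
Qed.

Lemma measurable_TH i : measurable (TH i).
Proof.
apply: open_measurable_rV.
by have [/(_ i) [_ [m [p ->]]] _ _ _] := TH_mesh; exact: open_interior.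
Qed.

Lemma TH_Omega i : TH i `<=` Omega.
Proof. by have [_ + _ _] := TH_mesh; exact. Qed.

Lemma bil_on_bilinear T : measurable T -> T `<=` Omega ->
  bilinear_on Vh (bil_on Omega A T).
Proof.
move=> mT TO w /Vh_H10 Hw; split=> c u v /Vh_H10 Hu /Vh_H10 Hv.
  exact: (bil_on_linr Omega_open A_coef c mT TO Hu Hv Hw).
exact: (bil_on_linl Omega_open A_coef c mT TO Hu Hv Hw).
Qed.

Lemma bil_bilinear : bilinear_on Vh a.
Proof. by apply: bil_on_bilinear => //; exact: open_measurable_rV. Qed.

Lemma bil_TH_bilinear i : bilinear_on Vh (aT i).
Proof. exact: (bil_on_bilinear (@measurable_TH i) (@TH_Omega i)). Qed.

Lemma load_linear : linear_on Vh (load Omega f).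
Proof.
have mO := open_measurable_rV Omega_open.
have int w : Vh w -> mu.-integrable Omega (EFin \o (fun x => f x * w x)).
  move=> /Vh_H10/H10_gradient[[mw iw] _ _]; apply: L2_integrableM_on => //.
  split; first exact: measurable_funS mw.
  exact: integrableS iw.
move=> c u v Vu Vv.
apply: (Rintegral_ae_lin mO (int _ _) (int _ Vu) (int _ Vv)).
  exact: Vh_subspace.2.
by apply: aeW => x; rewrite fct_linE; ring.
Qed.

Lemma Vh_spanned : finitely_spanned Vh.
Proof. by have [[n [b ->]] _ _] := Vh_fe; exists n, b. Qed.

Lemma corrector_on_is_corrector i u :
  Vh u -> is_corrector VfT a (fun i => aT i) i u (Q i u).
Proof.
move=> Vu.
have := @corrector_exists _ _ N Vh VfT a (fun i => aT i) VfT_subspace (@VfT_Vh)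
  Vh_spanned bil_bilinear bil_TH_bilinear Vh_definite i u Vu.
exact: (@xgetPex _ 0
  [set q | VfT i q /\ forall w, VfT i w -> a q w = aT i u w]).
Qed.

Hypothesis inf_sup_gt0 : (0 < inf_sup Omega TH Vh IH k A)%E.

(** For nonzero w with all these values 0, every quotient in the supremum
    attached to w would be 0, against the positivity of the infimum. *)
Lemma inf_sup_nondegenerate w : VH w ->
  (forall v, VH v -> a (w - \sum_i Q i w) v = 0) -> w = 0.
Proof.
move=> Vw wv0; apply: contrapT => w0.
have := inf_sup_gt0; rewrite ltNge => /negP; apply.
apply: (@le_trans _ _ (ereal_sup
   [set (a (w - Qsum w) vH / (norm_a Omega A (w - Qsum w) * norm1 Omega vH))%:E
      | vH in VH `\ 0])).
  by apply: ereal_inf_lbound; exists w.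
apply: ub_ereal_sup => _ [v [Vv _] <-].
by rewrite (_ : a _ v = 0) ?mul0r//; exact: (wv0 v Vv).
Qed.

Local Notation uHk := (pglod_solution Omega TH Vh IH k A f).

Lemma pglod_solutionP : VH uHk /\
  forall v, VH v -> a (uHk - \sum_i Q i uHk) v = load Omega f v.
Proof.
have := @coarse_solution_exists _ _ N Vh VH VfT a
  (fun i => aT i) (load Omega f)
  Vh_subspace VH_subspace VfT_subspace VH_Vh (@VfT_Vh)
  Vh_spanned bil_bilinear bil_TH_bilinear load_linear Vh_definite
  (fun i => Q i) corrector_on_is_corrector inf_sup_nondegenerate.
exact: (@xgetPex _ 0
  [set u | VH u /\ forall v, VH v -> a (u - Qsum u) v = load Omega f v]).
Qed.

Lemma two_scale_solutionP (rho : R) u : 0 < rho ->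
  two_scale_solution Omega TH Vh IH k A f rho u <-> u = (uHk, fun i => Q i uHk).
Proof.
move=> rho_gt0; have [VHu uP] := pglod_solutionP.
have r0 : Num.sqrt rho != 0 by rewrite gt_eqF ?sqrtr_gt0.
exact: (@two_scale_characterization _ _ N Vh VH VfT a
  (fun i => aT i) (load Omega f)
  Vh_subspace VH_subspace VfT_subspace VH_Vh (@VfT_Vh)
  bil_bilinear bil_TH_bilinear load_linear Vh_definite
  (fun i => Q i) corrector_on_is_corrector inf_sup_nondegenerate
  _ _ u r0 VHu uP).
Qed.

End pglod.

Theorem proposition4p1 (R : realType) (d p : nat) (d_gt0 : (0 < d)%N)
  (Omega : set 'rV[R]_d) (Omega_lip : bounded_lipschitz_domain Omega)
  (P : set 'rV[R]_p) (alpha beta : R) (alpha_gt0 : 0 < alpha)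
  (alpha_le_beta : alpha <= beta)
  (A : 'rV[R]_p -> 'rV[R]_d -> 'M[R]_d)
  (A_coef : forall nu, P nu -> coefficient Omega alpha beta (A nu))
  (f : 'rV[R]_d -> R) (f_L2 : L2 Omega f)
  (M : nat) (Th : 'I_M -> set 'rV[R]_d) (Th_mesh : is_mesh Omega Th)
  (kappa : R) (Th_regular : shape_regular kappa Th)
  (Vh : set ('rV[R]_d -> R)) (Vh_fe : conforming_fe_space Omega Th Vh)
  (N : nat) (TH : 'I_N -> set 'rV[R]_d) (TH_mesh : is_mesh Omega TH)
  (Th_TH : aligned Th TH)
  (k : nat)
  (C_IH : R) (IH : ('rV[R]_d -> R) -> 'rV[R]_d -> R)
  (IH_qi : quasi_interpolation Omega TH Vh C_IH IH)
  (rho : R) (rho_ge1 : 1 <= rho)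
  (mu : 'rV[R]_p) (mu_P : P mu)
  (inf_sup_gt0 : (0 < inf_sup Omega TH Vh IH k (A mu))%E) :
  let uHk := pglod_solution Omega TH Vh IH k (A mu) f in
  forall u : ('rV[R]_d -> R) * ('I_N -> 'rV[R]_d -> R),
    two_scale_solution Omega TH Vh IH k (A mu) f rho u <->
    u = (uHk, fun i => corrector_on Omega TH Vh IH k (A mu) i uHk).
Proof.
have [open_Omega _ _ bnd_Omega _] := Omega_lip.
move=> uHk u; apply: (two_scale_solutionP d_gt0 alpha_gt0 open_Omega bnd_Omega
  (A_coef mu mu_P) f_L2 Vh_fe TH_mesh IH_qi inf_sup_gt0).
exact: lt_le_trans rho_ge1.
Qed.
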